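(* Let $n\ge1$ and let $x=(x_1,\dots,x_{2n})$ be indeterminates. Then \begin{align*} A^{(1)}_{\mathrm{QT}}(4n;x;\zeta_4)&=2^{-2n^2+2n}\prod_{i=1}^{2n}x_i^{-2n+2}\prod_{1\le i<j\le 2n}(x_i^2+x_j^2)\,\operatorname{Hf}\Big(\frac{1}{x_i^2+x_j^2}\Big)_{1\le i,j\le 2n},\\ A^{(1)}_{\mathrm{QT}}(4n;x;\zeta_6)&=3^{-n^2+n}\prod_{i=1}^{2n}x_i^{-2n+2}\,\mathrm{GL}_{2n}\big(\delta(n-1,n-1);x_1^2,\dots,x_{2n}^2\big)^2,\\ A^{(1)}_{\mathrm{QT}}(4n;x;\zeta_8)&=2^{-n^2+n}\prod_{i=1}^{2n}x_i^{-2n+2}\,\mathrm{GL}_{2n}\big(\delta^2(2n-2,2n-2);x_1^2,\dots,x_{2n}^2\big),\\ A^{(2)}_{\mathrm{QT}}(4n;x;\zeta_4)&=2^{-2n^2+2n}\prod_{i=1}^{2n}x_i^{-2n+1}\prod_{1\le i<j\le 2n}(x_i^2+x_j^2),\\ A^{(2)}_{\mathrm{QT}}(4n;x;\zeta_6)&=3^{-n^2+n}\prod_{i=1}^{2n}x_i^{-2n+1}\,\mathrm{GL}_{2n}\big(\delta(n-1,n-1);x_1^2,\dots,x_{2n}^2\big)\,\mathrm{GL}_{2n}\big(\delta(n,n-1);x_1^2,\dots,x_{2n}^2\big),\\ A^{(2)}_{\mathrm{QT}}(4n;x;\zeta_8)&=2^{-n^2+n}\prod_{i=1}^{2n}x_i^{-2n+1}\prod_{1\le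 i<j\le 2n}(x_i^2+x_j^2). \end{align*}
   Context: $\sigma(t)=t-t^{-1}$, $\zeta_m=\exp(2\pi\sqrt{-1}/m)$. For $k\in\{1,2\}$ and a parameter $a$ let $M^{(k)}_{\mathrm{QT}}(n;x;a)$ be the skew-symmetric $2n\times2n$ matrix with entries $\dfrac{\sigma(x_j^k/x_i^k)}{\sigma(ax_j/x_i)\sigma(ax_i/x_j)}$, let $F_{\mathrm{QT}}(n;x;a)=\dfrac{\prod_{1\le i<j\le2n}\sigma(ax_j/x_i)\sigma(ax_i/x_j)}{\prod_{1\le i<j\le2n}\sigma(x_j/x_i)}$, and $A^{(k)}_{\mathrm{QT}}(4n;x;a)=\sigma(a)^{-2n^2+2n}F_{\mathrm{QT}}(n;x;a)\operatorname{Pf}M^{(k)}_{\mathrm{QT}}(n;x;a)$. $\operatorname{Pf}$ is the Pfaffian; for a symmetric $2n\times2n$ matrix $B$, the Hafnian $\operatorname{Hf}B$ is the sum over all perfect matchings $\{\{i_1,j_1\},\dots,\{i_n,j_n\}\}$ of $\{1,\dots,2n\}$ of $\prod_{k}B_{i_kj_k}$. Sequences: for $r\in\mathbb Z$, $\delta(r)=(r,r-1,\dots)$ consists of all $r-k\ge0$, $\delta^2(r)=(r,r-2,\dots)$ of all $r-2k\ge0$ ($k\in\mathbb Z_{\ge0}$), empty if $r<0$; $\delta(r,s)$, $\delta^2(r,s)$ arrange the entries of the two together in non-increasing order. As the index of a character in $N$ variables, such a sequence is replaced by its first $N$ entries (padded with zeros if shorter). For a partition $\lambda$ of length $\le N$,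 $\mathrm{GL}_N(\lambda;z)=\det(z_i^{\lambda_j+N-j})/\det(z_i^{N-j})$. *)

(* Defs.v *)
From HB Require Import structures.
From mathcomp Require Import all_boot all_order all_fingroup all_algebra.
From mathcomp Require Import fraction mpoly complex reals sequences exp trigo.
Set Implicit Arguments.
Unset Strict Implicit.
Unset Printing Implicit Defensive.
Import Order.TTheory GRing.Theory Num.Theory.
Local Open Scope ring_scope.

Section ComplexExponential.
Variable R : realType.

Definition cexp (z : R[i]) : R[i] :=
  let: Complex a b := z in Complex (expR a * cos b) (expR a * sin b).

Definition zeta (m : nat) : R[i] := cexp (2%:R * Complex 0 pi / m%:R).

End ComplexExponential.

(* The field C(x_1, ..., x_N), its constants and its indeterminates. *)
Definition ratfun (R : realType) (N : nat) : fieldType :=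
  {fraction {mpoly R[i][N]}}.

Definition ratC (R : realType) (N : nat) (c : R[i]) : ratfun R N :=
  tofrac (mpolyC N c).

Definition ratX (R : realType) (N : nat) (i : 'I_N) : ratfun R N :=
  tofrac (mpolyX R[i] (mnm1 i)).

Section PfaffianHafnian.
Variable K : fieldType.

Lemma pair_fst_subproof n (i : 'I_n) : (2 * i < 2 * n)%N.
Proof. by rewrite ltn_pmul2l. Qed.

Lemma pair_snd_subproof n (i : 'I_n) : ((2 * i).+1 < 2 * n)%N.
Proof. by rewrite !mul2n ltn_Sdouble. Qed.

Definition pair_fst n (i : 'I_n) : 'I_(2 * n) := Ordinal (pair_fst_subproof i).
Definition pair_snd n (i : 'I_n) : 'I_(2 * n) := Ordinal (pair_snd_subproof i).

(* The usual formula over the symmetric group; meaningful for a skew-symmetric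
   matrix over a field of characteristic 0. *)
Definition pfaffian n (A : 'M[K]_(2 * n)) : K :=
  (2 ^ n * n`!)%:R^-1 *
  \sum_(s : 'S_(2 * n))
    (-1) ^+ s * \prod_(i < n) A (s (pair_fst i)) (s (pair_snd i)).

Definition perfect_matchings N : {set {set {set 'I_N}}} :=
  [set P | partition P [set: 'I_N] & [forall b in P, #|b| == 2%N]].

(* Each block {i, j} is read as the pair with i < j, which is harmless for a
   symmetric matrix. *)
Definition hafnian N (B : 'M[K]_N) : K :=
  \sum_(P in perfect_matchings N)
    \prod_(i < N) \prod_(j < N | (i < j)%N && ([set i; j] \in P)) B i j.

End PfaffianHafnian.

(* delta_step d r is (r, r - d, r - 2d, ...), all terms nonnegative (d > 0). *)
Definition delta_step (d : nat) (r : int) : seq nat :=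
  match r with
  | Posz m => [seq (m - d * k)%N | k <- iota 0 (m %/ d).+1]
  | Negz _ => [::]
  end.

Definition delta_step2 (d : nat) (r s : int) : seq nat :=
  sort geq (delta_step d r ++ delta_step d s).

Notation delta := (delta_step2 1).
Notation delta2 := (delta_step2 2).

Section QT.
Variable K : fieldType.

(* With rows and columns numbered from 0, the exponent lambda_j + N - j becomes
   lam`_j + (N - j.+1).  Since nth has default 0, exactly the first N entries of
   lam are used, padded with zeros if lam is shorter. *)
Definition GLchar (N : nat) (lam : seq nat) (z : 'I_N -> K) : K :=
  \det (\matrix_(i < N, j < N) z i ^+ (nth 0%N lam j + (N - j.+1))) /
  \det (\matrix_(i < N, j < N) z i ^+ (N - j.+1)).

Definition sigma (t : K) : K := t - t^-1.

Definition MQT (k n : nat) (x : 'I_(2 * n) -> K) (a : K) : 'M[K]_(2 * n) :=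
  \matrix_(i, j) (sigma (x j ^+ k / x i ^+ k) /
                  (sigma (a * x j / x i) * sigma (a * x i / x j))).

Definition FQT (n : nat) (x : 'I_(2 * n) -> K) (a : K) : K :=
  (\prod_(i < 2 * n) \prod_(j < 2 * n | (i < j)%N)
      (sigma (a * x j / x i) * sigma (a * x i / x j))) /
  (\prod_(i < 2 * n) \prod_(j < 2 * n | (i < j)%N) sigma (x j / x i)).

(* A^(k)_QT(4n; x; a): the order 4n is twice the number of variables. *)
Definition AQT (k n : nat) (x : 'I_(2 * n) -> K) (a : K) : K :=
  sigma a ^ (- 2 * n%:Z ^+ 2 + 2 * n%:Z) * FQT x a * pfaffian (MQT k x a).

End QT.

(* Main.v *)
(* Put y = x^2.  Up to powers of sigma(a) and of the x_i, the function A^(k) is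
   prod_{i<j} Q_ij / (y_i - y_j) times the Pfaffian of (y_i^k - y_j^k) / Q_ij,
   where Q_ij = y_i^2 + y_j^2 - (a^2 + a^-2) y_i y_j.  At zeta_4, zeta_6, zeta_8,
   Q_ij is ((y_i^2 - y_j^2) / (y_i - y_j))^2, (y_i^3 - y_j^3) / (y_i - y_j),
   (y_i^4 - y_j^4) / (y_i^2 - y_j^2), so in all cases but one the entries are
   of the form (a_i - a_j)(b_i - b_j) / (X_i - X_j), with Pfaffian
   V(X;a) V(X;b) / prod_{i<j} (X_i - X_j) with V(X;a) the determinant with
   columns 1, a, X, aX, X^2, aX^2, ...  Expanding along the first row turns this
   identity into Lagrange interpolation in X_1 at the nodes X_2, ..., X_2n.
   For k = 1 at zeta_4 one needs
   Pf((y_i - y_j) / (y_i + y_j)^2) =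
     prod_{i<j} (y_i - y_j) / (y_i + y_j) * Hf(1 / (y_i + y_j)),
   again by interpolation in the first variable. *)
Require Import Defs.
From HB Require Import structures.
From mathcomp Require Import all_boot all_order all_fingroup all_algebra.
From mathcomp Require Import fraction mpoly complex reals sequences exp trigo.
From mathcomp Require Import ring zify.
Set Implicit Arguments.
Unset Strict Implicit.
Unset Printing Implicit Defensive.
Import Order.TTheory GRing.Theory Num.Theory.
Local Open Scope ring_scope.

(** * Pfaffians as sums over permutations, and their first-row expansion *)

Section PfaffianSum.
Variable F : fieldType.

Lemma dfst_subproof n (i : 'I_n) : (i.*2 < n.*2)%N.
Proof. by rewrite ltn_double. Qed.

Lemma dsnd_subproof n (i : 'I_n) : (i.*2.+1 < n.*2)%N.
Proof. by rewrite ltn_Sdouble. Qed.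

(** Indices live in ['I_n.*2] because [n.+1.*2] computes to [n.*2.+2], so that [ord0] and [lift]
    apply without casts. *)
Definition dfst n (i : 'I_n) : 'I_n.*2 := Ordinal (dfst_subproof i).
Definition dsnd n (i : 'I_n) : 'I_n.*2 := Ordinal (dsnd_subproof i).

Definition pfterm n (A : 'I_n.*2 -> 'I_n.*2 -> F) (s : 'S_n.*2) : F :=
  (-1) ^+ s * \prod_(i < n) A (s (dfst i)) (s (dsnd i)).

Definition pfsum n (A : 'I_n.*2 -> 'I_n.*2 -> F) : F :=
  \sum_(s : 'S_n.*2) pfterm A s.

Definition pf n (A : 'I_n.*2 -> 'I_n.*2 -> F) : F :=
  (2 ^ n * n`!)%:R^-1 * pfsum A.

Lemma pfaffian_pf n (e : n.*2 = (2 * n)%N) (A : 'M[F]_(2 * n)) :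
  pfaffian A = pf (fun i j => A (cast_ord e i) (cast_ord e j)).
Proof.
rewrite /pfaffian /pf /pfsum /pfterm; congr (_ * _).
(* [pair_fst] and [pair_snd] become opaque functions known only by their values, so that [2 * n] can
   be generalized and [e] eliminated. *)
have [f fE] : exists f : 'I_n -> 'I_(2 * n), f = @pair_fst n by eexists.
have [g gE] : exists g : 'I_n -> 'I_(2 * n), g = @pair_snd n by eexists.
have fval i : f i = i.*2 :> nat by rewrite fE /= mul2n.
have gval i : g i = i.*2.+1 :> nat by rewrite gE /= mul2n.
rewrite -fE -gE; move: (2 * n)%N e A f g {fE gE} fval gval => N e.
case: _ / e => A f g fval gval; apply: eq_bigr => s _; congr (_ * _).
apply: eq_bigr => i _; rewrite !cast_ord_id.
by congr (A (s _) (s _)); apply: val_inj; rewrite /= ?fval ?gval.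
Qed.

Lemma eq_pf n (A B : 'I_n.*2 -> 'I_n.*2 -> F) :
  (forall i j, A i j = B i j) -> pf A = pf B.
Proof.
move=> AB; congr (_ * _); apply: eq_bigr => s _; congr (_ * _).
exact: eq_bigr.
Qed.

Lemma dfst_neq_dsnd n (i j : 'I_n) : dfst i != dsnd j.
Proof.
apply/eqP=> /(congr1 val) /= /(congr1 odd).
by rewrite /= !odd_double.
Qed.

Lemma dfst_inj n : injective (@dfst n).
Proof. by move=> i j /(congr1 val) /= /double_inj /val_inj. Qed.

Lemma dsnd_inj n : injective (@dsnd n).
Proof. by move=> i j /(congr1 val) /= [] /double_inj /val_inj. Qed.

Lemma dpos_cases n (p : 'I_n.*2) : exists b, p = dfst b \/ p = dsnd b.
Proof.
have pn : (p./2 < n)%N by rewrite ltn_half_double.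
exists (Ordinal pn); case: (boolP (odd p)) => po; [right|left];
  by apply: val_inj; rewrite /= -{1}(odd_double_half p) ?po ?(negbTE po).
Qed.

(** The sign of the transposition cancels the sign from skew-symmetry. *)
Lemma pfterm_swap_in_block n (A : 'I_n.*2 -> 'I_n.*2 -> F) b s :
  (forall i j, A i j = - A j i) ->
  pfterm A (tperm (dfst b) (dsnd b) * s) = pfterm A s.
Proof.
move=> skewA; rewrite /pfterm odd_permM odd_tperm dfst_neq_dsnd /=.
rewrite (bigD1 b) // [in RHS](bigD1 b) //= !permM tpermL tpermR skewA.
rewrite signrN mulNr -mulrN -mulNr opprK.
congr (_ * (_ * _)); apply: eq_bigr => i nib.
rewrite !permM !tpermD // ?(inj_eq (@dfst_inj _)) ?(inj_eq (@dsnd_inj _)) //;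
  by rewrite 1?eq_sym ?dfst_neq_dsnd 1?eq_sym ?dfst_neq_dsnd // eq_sym.
Qed.

(** Together the two transpositions are even, and the factors are merely permuted by [tperm b c]. *)
Lemma pfterm_swap_blocks n (A : 'I_n.*2 -> 'I_n.*2 -> F) b c s :
  pfterm A (tperm (dfst b) (dfst c) * tperm (dsnd b) (dsnd c) * s) =
  pfterm A s.
Proof.
rewrite /pfterm !odd_permM !odd_tperm.
rewrite (inj_eq (@dfst_inj _)) (inj_eq (@dsnd_inj _)) addbb addFb; congr (_ * _).
rewrite [in RHS](reindex_inj (@perm_inj _ (tperm b c))) /=.
apply: eq_bigr => i _; rewrite !permM.
have dfstE : tperm (dfst b) (dfst c) (dfst i) = dfst (tperm b c i).
  by rewrite (inj_tperm _ _ _ (@dfst_inj _)).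
have dsndE : tperm (dsnd b) (dsnd c) (dsnd i) = dsnd (tperm b c i).
  by rewrite (inj_tperm _ _ _ (@dsnd_inj _)).
rewrite dfstE [tperm (dfst b) _ (dsnd i)]tpermD ?dfst_neq_dsnd // dsndE.
by rewrite [tperm (dsnd b) _ _]tpermD // eq_sym dfst_neq_dsnd.
Qed.

(** Terms are grouped by the position of index 0. Swapping blocks, and then the two places of a
    block, carries position 0 to any other without changing a term, so the [2 * n.+1] groups have
    equal sums. *)
Lemma pfsum_stab_first n (A : 'I_n.+1.*2 -> 'I_n.+1.*2 -> F) :
  (forall i j, A i j = - A j i) ->
  pfsum A = (2 * n.+1)%:R *
    \sum_(s : 'S_n.*2.+2 | s ord0 == ord0) pfterm (n := n.+1) A s.
Proof.
move=> skewA; rewrite /pfsum.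
rewrite (partition_big (fun s : 'S_n.*2.+2 => (s^-1)%g ord0) xpredT) //=.
rewrite (eq_bigr (fun=> \sum_(s : 'S_n.*2.+2 | s ord0 == ord0)
                          pfterm (n := n.+1) A s)).
  by rewrite sumr_const card_ord mulr_natl mul2n.
move=> p _.
suff [t [t0 tA]] : exists t : 'S_n.*2.+2, t ord0 = p /\
    forall s, pfterm (n := n.+1) A (t * s) = pfterm (n := n.+1) A s.
  rewrite [RHS](reindex_inj (mulgI t)) /=.
  apply: eq_big => s; last by rewrite tA.
  by rewrite permM t0 -(inj_eq (@perm_inj _ s)) permKV eq_sym.
have dfst0 : (ord0 : 'I_n.*2.+2) = dfst (ord0 : 'I_n.+1) by apply: val_inj.
case: (@dpos_cases n.+1 p) => b [] ->.
  exists (tperm (dfst ord0) (dfst b) * tperm (dsnd ord0) (dsnd b))%g; split.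
    by rewrite permM dfst0 tpermL tpermD // eq_sym dfst_neq_dsnd.
  by move=> s; exact: (@pfterm_swap_blocks n.+1 A).
exists (tperm (dfst ord0) (dfst b) * tperm (dsnd ord0) (dsnd b) *
  tperm (dfst b) (dsnd b))%g; split.
  rewrite !permM dfst0 tpermL.
  by rewrite [X in tperm _ _ X]tpermD ?tpermL // eq_sym dfst_neq_dsnd.
move=> s; rewrite -mulgA; apply: etrans (@pfterm_swap_blocks n.+1 A _ _ _) _.
exact: pfterm_swap_in_block.
Qed.

(** These are the permutations whose first block is (0, [lift ord0 j]): the outer lift fixes 0, the
    inner one sends position 1 to [lift ord0 j] and accounts for the sign. *)
Lemma pfterm_lift n (A : 'I_n.+1.*2 -> 'I_n.+1.*2 -> F) j (s : 'S_n.*2) :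
  pfterm (n := n.+1) A (lift_perm ord0 ord0 (lift_perm ord0 j s)) =
  (-1) ^+ j * A ord0 (lift ord0 j) *
  pfterm (fun k l => A (lift ord0 (lift j k)) (lift ord0 (lift j l))) s.
Proof.
rewrite /pfterm !odd_lift_perm /= signr_addb -!mulrA.
rewrite -[in RHS](signr_odd _ j); congr (_ * _); rewrite mulrCA; congr (_ * _).
have dfst0 : dfst (ord0 : 'I_n.+1) = ord0 by apply: val_inj.
have dsnd0 : dsnd (ord0 : 'I_n.+1) = lift ord0 ord0 by apply: val_inj.
rewrite big_ord_recl dfst0 dsnd0 lift_perm_id !lift_perm_lift lift_perm_id.
congr (_ * _); apply: eq_bigr => i _.
have dfstS : dfst (lift ord0 i) = lift ord0 (lift ord0 (dfst i)) by apply: val_inj.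
have dsndS : dsnd (lift ord0 i) = lift ord0 (lift ord0 (dsnd i)) by apply: val_inj.
by rewrite dfstS dsndS !lift_perm_lift.
Qed.

Lemma sum_perm_fix_lift m (T : 'S_m.+1 -> F) i j :
  \sum_(s : 'S_m.+1 | s i == j) T s = \sum_(s : 'S_m) T (lift_perm i j s).
Proof.
rewrite (reindex (lift_perm i j)) /=.
  by apply: eq_bigl => s; rewrite lift_perm_id eqxx.
(* [ulsf i s] is [s] with [i] deleted from the source and [s i] from the target; this inverts
   [lift_perm]. *)
pose ulsf i (s : 'S_m.+1) k := odflt k (unlift (s i) (s (lift i k))).
have ulsfK i' (s : 'S_m.+1) k : lift (s i') (ulsf i' s k) = s (lift i' k).
  rewrite /ulsf; have := neq_lift i' k.
  by rewrite -(can_eq (permK s)) => /unlift_some[] ? ? ->.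
have inj_ulsf : injective (ulsf i _).
  move=> s; apply: can_inj (ulsf (s i) s^-1%g) _ => k'.
  by rewrite {1}/ulsf ulsfK !permK liftK.
exists (fun s => perm (inj_ulsf s)) => [s _ | s].
  by apply/permP=> k'; rewrite permE /ulsf lift_perm_lift lift_perm_id liftK.
move/(s _ =P _) => si0; apply/permP=> k.
case: (unliftP i k) => [k'|] ->; rewrite ?lift_perm_id //.
by rewrite lift_perm_lift -si0 permE ulsfK.
Qed.

Hypothesis char0 : forall m, (m.+1)%:R != 0 :> F.

(** The factor [2 * n.+1] of [pfsum_stab_first] turns the normalization 2^(n+1) (n+1)! into the 2^n
    n! of the smaller Pfaffians. *)
Lemma pf_expand n (A : 'I_n.+1.*2 -> 'I_n.+1.*2 -> F) :
  (forall i j, A i j = - A j i) ->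
  pf A = \sum_(j < n.*2.+1) (-1) ^+ j * A ord0 (lift ord0 j) *
    pf (fun k l => A (lift ord0 (lift j k)) (lift ord0 (lift j l))).
Proof.
move=> skewA; rewrite /pf pfsum_stab_first // sum_perm_fix_lift.
rewrite (partition_big (fun s : 'S_n.*2.+1 => s ord0) xpredT) //=.
rewrite !mulr_sumr; apply: eq_bigr => j _; rewrite sum_perm_fix_lift.
rewrite [RHS]mulrCA /pfsum !mulr_sumr; apply: eq_bigr => s _.
rewrite pfterm_lift !mulrA; congr (_ * _ * _ * _).
rewrite expnS factS mulnACA [in (_ * (2 ^ n * _))%:R]natrM invfM.
by congr (_ * _); rewrite mulrAC mulVf ?mul1r // mulnS add2n.
Qed.

(** Composing with the transposition of [p] and [q] on the value side preserves every entry and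
    flips every sign; hence [pfsum A] is its own opposite, and 2 is invertible. *)
Lemma pf_eq_rows n (A : 'I_n.*2 -> 'I_n.*2 -> F) p q :
  (forall i j, A i j = - A j i) -> p != q -> (forall j, A p j = A q j) ->
  pf A = 0.
Proof.
move=> skewA npq Apq.
have Atp i j : A (tperm p q i) (tperm p q j) = A i j.
  have Atl k l : A (tperm p q k) l = A k l by case: tpermP => // ->.
  by rewrite Atl skewA Atl -skewA.
have : pfsum A = - pfsum A.
  rewrite {1}/pfsum (reindex_inj (mulIg (tperm p q))) -sumrN.
  apply: eq_bigr => s _; rewrite /pfterm odd_permM odd_tperm npq.
  rewrite addbT signrN mulNr; congr (- (_ * _)).
  by apply: eq_bigr => i _; rewrite !permM Atp.
move/eqP; rewrite -addr_eq0 -mulr2n -mulr_natr mulf_eq0 (negbTE (char0 1)) orbF.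
by rewrite /pf => /eqP ->; rewrite mulr0.
Qed.

End PfaffianSum.

(** * Products over pairs i < j *)

Section PairProduct.
Variable F : fieldType.

Definition pairprod N (f : 'I_N -> 'I_N -> F) : F :=
  \prod_(i < N) \prod_(j < N | (i < j)%N) f i j.

Lemma eq_pairprod N (f g : 'I_N -> 'I_N -> F) :
  (forall i j : 'I_N, (i < j)%N -> f i j = g i j) -> pairprod f = pairprod g.
Proof. by move=> fg; apply: eq_bigr => i _; apply: eq_bigr => j; apply: fg. Qed.

Lemma pairprodM N (f g : 'I_N -> 'I_N -> F) :
  pairprod (fun i j => f i j * g i j) = pairprod f * pairprod g.
Proof.
by rewrite /pairprod -big_split; apply: eq_bigr => i _; rewrite -big_split.
Qed.

Lemma pairprodV N (f : 'I_N -> 'I_N -> F) :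
  pairprod (fun i j => (f i j)^-1) = (pairprod f)^-1.
Proof.
rewrite /pairprod -[RHS]prodfV; apply: eq_bigr => i _.
by rewrite -[RHS]prodfV.
Qed.

Lemma pairprod_neq0 N (f : 'I_N -> 'I_N -> F) :
  (forall i j : 'I_N, (i < j)%N -> f i j != 0) -> pairprod f != 0.
Proof.
move=> f0; apply/prodf_neq0 => i _; apply/prodf_neq0 => j; exact: f0.
Qed.

Lemma pairprod_recl N (f : 'I_N.+1 -> 'I_N.+1 -> F) :
  pairprod f = \prod_(j < N) f ord0 (lift ord0 j) *
    pairprod (fun i j => f (lift ord0 i) (lift ord0 j)).
Proof.
rewrite /pairprod big_ord_recl big_mkcond big_ord_recl /= mul1r.
congr (_ * _); apply: eq_bigr => i _.
by rewrite big_mkcond big_ord_recl /= mul1r [RHS]big_mkcond.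
Qed.

Lemma prod_sign_lt N (j : 'I_N.+1) :
  \prod_(k < N) (if (lift j k < j)%N then -1 else 1 : F) = (-1) ^+ j.
Proof.
rewrite (eq_bigr (fun k : 'I_N => if (k < j)%N then -1 else 1 : F)).
  rewrite -big_mkcond -(big_ord_widen _ (fun=> -1 : F)) ?prodr_const ?card_ord //.
  by rewrite -ltnS.
move=> k _; rewrite /= /bump; case: (leqP j k) => [jk|kj]; last by rewrite kj.
by rewrite ltnNge leqW.
Qed.

(** Moving index [j] to the front reverses the [j] pairs in which it came second, one sign each. *)
Lemma pairprod_lift N (f : 'I_N.+1 -> 'I_N.+1 -> F) (j : 'I_N.+1) :
  (forall i k, f i k = - f k i) ->
  pairprod f = (-1) ^+ j * \prod_(k < N) f j (lift j k) *
    pairprod (fun i k => f (lift j i) (lift j k)).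
Proof.
move=> skewf; rewrite /pairprod (bigD1_ord j) //= big_mkcond (bigD1_ord j) //=.
rewrite ltnn mul1r.
under [X in _ * X = _]eq_bigr do rewrite big_mkcond (bigD1_ord j) //=.
rewrite big_split mulrA /=; congr (_ * _); last first.
  apply: eq_bigr => i _; rewrite [RHS]big_mkcond; apply: eq_bigr => k _ /=.
  congr (if _ then _ else _); rewrite /bump; do 2!case: leqP; lia.
rewrite -prod_sign_lt -!big_split; apply: eq_bigr => k _ /=.
have := neq_lift j k; rewrite -val_eqE /= neq_ltn.
case: ltngtP => // _ _; first by rewrite mulr1 mul1r.
by rewrite mul1r mulN1r skewf.
Qed.

End PairProduct.

(** * Polynomial interpolation *)

Section Interpolation.
Variable F : fieldType.

Lemma poly_eq_of_evals (T : finType) (t : T -> F) (p q : {poly F}) :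
  injective t -> (size p <= #|T|)%N -> (size q <= #|T|)%N ->
  (forall i, p.[t i] = q.[t i]) -> p = q.
Proof.
move=> tinj sp sq pq; apply/eqP; rewrite -subr_eq0; apply/eqP.
apply: (@roots_geq_poly_eq0 _ _ [seq t i | i <- enum T]).
- by apply/allP => _ /mapP[i _ ->]; rewrite rootE !hornerE pq subrr.
- by rewrite map_inj_uniq ?enum_uniq.
- rewrite size_map -cardE (leq_trans (size_polyD _ _)) // size_polyN.
  by rewrite geq_max sp.
Qed.

Lemma size_prod_XaddC m (t : 'I_m -> F) :
  size (\prod_(k < m) ('X + (t k)%:P)) = m.+1.
Proof.
under eq_bigr do rewrite -[(t _)%:P]opprK -polyCN.
by rewrite size_prod_XsubC /index_enum -enumT size_enum_ord.
Qed.

(** The nodes other than [t j] are listed by [lift j], the numbering that [pf_expand] uses for the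
    remaining indices. *)
Lemma lagrange_eval m (t : 'I_m.+1 -> F) (p : {poly F}) z :
  injective t -> (size p <= m.+1)%N ->
  p.[z] = \sum_j p.[t j] *
    \prod_(k < m) ((z - t (lift j k)) / (t j - t (lift j k))).
Proof.
move=> tinj sp.
pose q := \sum_j (p.[t j] / \prod_(k < m) (t j - t (lift j k))) *:
   \prod_(k < m) ('X - (t (lift j k))%:P).
have qE y : q.[y] = \sum_j p.[t j] *
    \prod_(k < m) ((y - t (lift j k)) / (t j - t (lift j k))).
  rewrite /q horner_sum; apply: eq_bigr => j _; rewrite hornerZ -mulrA; congr (_ * _).
  rewrite mulrC -prodfV horner_prod -big_split; apply: eq_bigr => k _ /=.
  by rewrite hornerXsubC.
rewrite -qE; congr (_.[z]); apply: (poly_eq_of_evals tinj); rewrite ?card_ord //.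
  apply: (leq_trans (size_sum _ _ _)); apply/bigmax_leqP => j _.
  apply: (leq_trans (size_scale_leq _ _)).
  by rewrite size_prod_XsubC /index_enum -enumT size_enum_ord.
move=> i; rewrite qE (bigD1 i) //= [X in _ + X]big1 ?addr0 => [|j nji].
  rewrite big1 ?mulr1 // => k _; rewrite divff // subr_eq0.
  by rewrite (inj_eq tinj) neq_lift.
by have [k ->] := unlift_some nji;
  rewrite (bigD1 k) //= subrr mul0r mul0r mulr0.
Qed.

End Interpolation.

(** * The Pfaffian of (a_i - a_j)(b_i - b_j) / (x_i - x_j) *)

Section PfaffianVandermonde.
Variable F : fieldType.

Definition vdet N (x a : 'I_N -> F) : F :=
  \det (\matrix_(i < N, c < N) (a i ^+ odd c * x i ^+ c./2)).

Definition fcons N (t : F) (x : 'I_N -> F) (i : 'I_N.+1) : F :=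
  oapp x t (unlift ord0 i).

Lemma fcons0 N t (x : 'I_N -> F) : fcons t x ord0 = t.
Proof. by rewrite /fcons unlift_none. Qed.

Lemma fconsS N t (x : 'I_N -> F) i : fcons t x (lift ord0 i) = x i.
Proof. by rewrite /fcons liftK. Qed.

Lemma fcons_eta N (x : 'I_N.+1 -> F) i :
  fcons (x ord0) (fun j => x (lift ord0 j)) i = x i.
Proof. by case: (unliftP ord0 i) => [j|] ->; rewrite ?fconsS ?fcons0. Qed.

Lemma eq_vdet N (x x' a a' : 'I_N -> F) :
  x =1 x' -> a =1 a' -> vdet x a = vdet x' a'.
Proof.
by move=> xx aa; congr (\det _); apply/matrixP=> i c; rewrite !mxE xx aa.
Qed.

(** The expansion of [vdet] along row 0, as a polynomial in the first node. The [0] in [fcons 0 x]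
    is a placeholder: cofactors of row 0 do not see it. *)
Definition vpoly N (a0 : F) (x a : 'I_N -> F) : {poly F} :=
  \sum_(c < N.+1) (a0 ^+ odd c * cofactor (\matrix_(i < N.+1, c' < N.+1)
    (fcons a0 a i ^+ odd c' * fcons 0 x i ^+ c'./2)) ord0 c) *: 'X^(c./2).

Lemma horner_vpoly N a0 (x a : 'I_N -> F) t :
  (vpoly a0 x a).[t] = vdet (fcons t x) (fcons a0 a).
Proof.
rewrite /vdet (expand_det_row _ ord0) horner_sum; apply: eq_bigr => c _.
rewrite hornerZ hornerXn mxE !fcons0 mulrAC; congr (_ * _).
rewrite /cofactor; congr (_ * \det _).
by apply/matrixP=> i j; rewrite !mxE !fconsS.
Qed.

(** The last of the 2n+2 columns carries the power n. A product of two such polynomials thus has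
    size at most 2n+1, the number of interpolation nodes. *)
Lemma size_vpoly n a0 (x a : 'I_n.*2.+1 -> F) :
  (size (vpoly a0 x a) <= n.+1)%N.
Proof.
apply: (leq_trans (size_sum _ _ _)); apply/bigmax_leqP => c _.
apply: (leq_trans (size_scale_leq _ _)); rewrite size_polyXn ltnS.
by have := ltn_ord c; lia.
Qed.

(* Column operations c <- c - x_j * (c - 2) clear the two rows with equal [x],
   except in columns 0 and 1. *)
Lemma vdet_collision N (x a : 'I_N.+1 -> F) a0 j :
  vdet (fcons (x j) x) (fcons a0 a) =
  (-1) ^+ j * (a j - a0) * \prod_(k < N) (x (lift j k) - x j) *
  vdet (fun k => x (lift j k)) (fun k => a (lift j k)).
Proof.
set y := fcons (x j) x; set b := fcons a0 a; rewrite /vdet.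
set M := (\matrix_(i, c) _ in LHS).
pose U : 'M[F]_N.+2 := \matrix_(c', c)
  ((c' == c)%:R - x j *+ (c == c'.+2 :> nat)).
have detU : \det U = 1.
  rewrite -det_tr det_trig; last first.
    apply/is_trig_mxP => c c' ltcc'; rewrite !mxE.
    rewrite -val_eqE /= (gtn_eqF ltcc') (ltn_eqF (leqW (leqW ltcc'))).
    by rewrite mulr0n subrr.
  rewrite big1 // => c _; rewrite !mxE eqxx.
  by rewrite ltn_eqF ?mulr0n ?subr0 // leqW.
rewrite -[LHS]mulr1 -[X in _ * X = _]detU -det_mulmx.
have MUE i (c : 'I_N.+2) : (M *m U) i c =
    b i ^+ odd c * (y i ^+ c./2 - if (1 < c)%N then x j * y i ^+ c./2.-1 else 0).
  rewrite mxE; under eq_bigr do rewrite !mxE mulrBr.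
  rewrite sumrB mulrBr (bigD1 c) //= eqxx mulr1 big1 ?addr0; last first.
    by move=> k /negPf ->; rewrite mulr0.
  congr (_ - _); case: ltnP => [c1|c1]; last first.
    rewrite big1 ?mulr0 // => k _; rewrite ltn_eqF ?mulr0n ?mulr0 //.
    by rewrite (leq_ltn_trans c1).
  have c2 : (c.-2 < N.+2)%N by have := ltn_ord c; lia.
  rewrite (bigD1 (Ordinal c2)) //= big1 ?addr0; last first.
    move=> k; rewrite -val_eqE /= => kc; rewrite (_ : (_ == _) = false) ?mulr0 //.
    by apply/negP => /eqP; lia.
  rewrite (_ : _ == _) ?mulr1n; last by apply/eqP; lia.
  have -> : odd c.-2 = odd c by case: (c : nat) c1 => [|[|m]] //= _; rewrite negbK.
  have -> : c.-2./2 = c./2.-1 by case: (c : nat) c1 => [|[|m]].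
  by rewrite -mulrA; congr (_ * _); rewrite mulrC.
(* Rows 0 and j+1 become (1, a0, 0, ...) and (1, a_j, 0, ...), so only two minors of row 0 count,
   and they combine to the factor a_j - a0. *)
have MU0 : forall c, (M *m U) ord0 c = if c == ord0 then 1 else
    if c == lift ord0 ord0 then a0 else 0.
  move=> c; rewrite MUE /y /b !fcons0.
  case: c => [[|[|c]] cN] /=; rewrite ?expr0 ?expr1 ?subr0 ?mulr1 //.
  by rewrite -exprS subrr mulr0.
have MUj : forall c, (M *m U) (lift ord0 j) c = if c == ord0 then 1 else
    if c == lift ord0 ord0 then a j else 0.
  move=> c; rewrite MUE /y /b !fconsS.
  case: c => [[|[|c]] cN] /=; rewrite ?expr0 ?expr1 ?subr0 ?mulr1 //.
  by rewrite -exprS subrr mulr0.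
set D := (X in _ = _ * X); set P := (X in _ = _ * X * _).
have blockE : \det (\matrix_(i < N, k < N)
    ((x (lift j i) - x j) * (a (lift j i) ^+ odd k * x (lift j i) ^+ k./2))) = P * D.
  have -> : P = \det (diag_mx (\row_(i < N) (x (lift j i) - x j))).
    by rewrite det_diag; apply: eq_bigr => i _; rewrite mxE.
  rewrite /D -det_mulmx; congr (\det _); apply/matrixP=> i k.
  by rewrite mul_diag_mx !mxE.
(* [h] is the column deleted along with row 0, either 0 or 1; [u] is the one entry that survives in
   row [j] of the minor. *)
have minorE (h : 'I_N.+2) (u : F) :
    (forall c, (M *m U) (lift ord0 j) (lift h c) = if c == ord0 then u else 0) ->
    (forall k : 'I_N, lift h (lift ord0 k) = k.+2 :> nat) ->
  \det (row' ord0 (col' h (M *m U))) = (-1) ^+ j * u * (P * D).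
  move=> rowj hk; rewrite (expand_det_row _ j) (bigD1 ord0) //= big1 ?addr0; last first.
    by move=> c nc; rewrite 2![in X in X * _]mxE rowj (negPf nc) mul0r.
  rewrite 2![in X in X * _]mxE rowj eqxx /cofactor addn0 mulrCA -mulrA.
  congr (_ * (_ * _)); rewrite -blockE; congr (\det _); apply/matrixP=> i k.
  rewrite 4![LHS]mxE MUE hk /y /b !fconsS [RHS]mxE /= negbK exprS.
  by rewrite -mulrBl mulrCA.
rewrite (expand_det_row _ ord0) big_ord_recl big_ord_recl big1 ?addr0; last first.
  by move=> c _; rewrite MU0 /= mul0r.
rewrite !MU0 /= /cofactor (minorE ord0 (a j)) //; last first.
  by move=> c; rewrite MUj -val_eqE.
rewrite (minorE (lift ord0 ord0) 1) //; last first.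
  move=> c; rewrite MUj -!val_eqE /= /bump.
  by case: (c : nat) => [|[|m]].
by rewrite /bump; ring.
Qed.

Lemma prod_subC_even n (f g : 'I_n.*2 -> F) :
  \prod_k (f k - g k) = \prod_k (g k - f k).
Proof.
under eq_bigr do rewrite -opprB.
by rewrite prodrN card_ord -signr_odd odd_double mul1r.
Qed.

Hypothesis char0 : forall m, (m.+1)%:R != 0 :> F.

Lemma pf0 (A : 'I_0.*2 -> 'I_0.*2 -> F) : pf A = 1.
Proof.
rewrite /pf /pfsum (eq_bigr (fun=> 1)) => [|s _].
  by rewrite sumr_const card_Sn mulr1 invr1.
rewrite /pfterm big_ord0 mulr1 (_ : s = 1%g) ?odd_perm1 //.
by apply/permP => -[].
Qed.

(** Induction on [n], comparing the j-th term of the first-row expansion with the j-th Lagrange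
    term. At that node [vdet_collision] reduces both determinants to the points left over, where the
    induction hypothesis applies. *)
Lemma pf_vandermonde n (x a b : 'I_n.*2 -> F) : injective x ->
  pf (fun i j => (a i - a j) * (b i - b j) / (x i - x j)) *
    pairprod (fun i j => x i - x j) = vdet x a * vdet x b.
Proof.
elim: n x a b => [|n IHn] x a b xinj.
  by rewrite pf0 /pairprod big_ord0 /vdet !det_mx00.
have skew i j : (a i - a j) * (b i - b j) / (x i - x j) =
    - ((a j - a i) * (b j - b i) / (x j - x i)).
  by rewrite -[x j - x i]opprB invrN mulrN opprK -[a j - _]opprB -[b j - _]opprB mulrNN.
rewrite (pf_expand char0 skew).
pose sub (T : Type) (f : 'I_n.*2.+2 -> T) (j : 'I_n.*2.+1) := f (lift ord0 j).
have xsinj : injective (sub _ x) by move=> i j /xinj /lift_inj.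
have vE c : vdet x c = (vpoly (c ord0) (sub _ x) (sub _ c)).[x ord0].
  by rewrite horner_vpoly; apply: eq_vdet => i; rewrite [RHS]fcons_eta.
rewrite (vE a) (vE b) -hornerM (lagrange_eval _ xsinj); last first.
  apply: (leq_trans (size_polyMleq _ _)).
  have := size_vpoly (a ord0) (sub _ x) (sub _ a).
  have := size_vpoly (b ord0) (sub _ x) (sub _ b).
  by lia.
rewrite mulr_suml; apply: eq_bigr => j _.
rewrite hornerM !horner_vpoly !vdet_collision.
rewrite (@pairprod_recl _ n.*2.+1) (@pairprod_lift _ n.*2 _ j); last first.
  by move=> i k; rewrite opprB.
have := IHn (fun k => sub _ x (lift j k)) (fun k => sub _ a (lift j k))
  (fun k => sub _ b (lift j k)) (inj_comp xsinj (@lift_inj _ j)).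
rewrite (bigD1_ord j) //= -/(sub _ x j).
rewrite [X in X * _ = _ -> _](_ : _ = pf (fun k l : 'I_n.*2 =>
  (a (lift ord0 (lift j k)) - a (lift ord0 (lift j l))) *
  (b (lift ord0 (lift j k)) - b (lift ord0 (lift j l))) /
  (x (lift ord0 (lift j k)) - x (lift ord0 (lift j l))))) //.
rewrite -/(sub _ x j) -/(sub _ a j) -/(sub _ b j).
rewrite prodf_div (prod_subC_even (fun k => sub _ x (lift j k))).
have P0 : \prod_(k < n.*2) (sub _ x j - sub _ x (lift j k)) != 0.
  by apply/prodf_neq0 => k _; rewrite subr_eq0 (inj_eq xsinj) neq_lift.
have D0 : x ord0 - sub _ x j != 0.
  by rewrite subr_eq0 (inj_eq xinj) neq_lift.
move: (pf _) (pairprod _) (vdet _ _) (vdet _ _) => p d va vb E.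
rewrite -[\prod_(i < n.*2) (x ord0 - x _)]/(\prod_(i < n.*2) (x ord0 - sub _ x (lift j i))).
rewrite -[\prod_(k < n.*2) (sub _ x j - x _)]/(\prod_(k < n.*2) (sub _ x j - sub _ x (lift j k))).
move: (\prod_(k < n.*2) (sub _ x j - _)) P0 (\prod_(i < n.*2) _) => P P0 Q.
move: ((-1) ^+ j) (x ord0 - sub _ x j) D0 => s D D0.
move: (a ord0) (sub _ a j) (b ord0) (sub _ b j) => a0 aj b0 bj.
transitivity (s * s * (a0 - aj) * (b0 - bj) * P * Q * (p * d)); first by field.
by rewrite E; field.
Qed.

End PfaffianVandermonde.

(** * Hafnians over subsets of the indices, and their expansion *)

Section HafnianExpansion.
Variables (F : fieldType) (N : nat).
Implicit Types (B : 'I_N -> 'I_N -> F) (S : {set 'I_N}) (P : {set {set 'I_N}}).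

Definition pmatching P S := partition P S && [forall b in P, #|b| == 2].

(** For a pair [b] exactly one factor occurs, ordered as in [hafnian]. *)
Definition haf_block B (b : {set 'I_N}) : F :=
  \prod_(i < N) \prod_(j < N | (i < j)%N && ([set i; j] == b)) B i j.

(** The Hafnian of the submatrix on [S], kept over a fixed index type: removing a pair shrinks [S]
    and no block has to be renumbered. *)
Definition hafset B S : F :=
  \sum_(P | pmatching P S) \prod_(b in P) haf_block B b.

Lemma hafnian_hafset B :
  hafnian (\matrix_(i, j) B i j) = hafset B [set: 'I_N].
Proof.
rewrite /hafnian; apply: eq_big => [P|P _]; first by rewrite inE.
rewrite /haf_block exchange_big; apply: eq_bigr => i _ /=.
(* The pairs i < j are grouped by the block they span. *)
rewrite (partition_big (fun j => [set i; j]) (mem P)) /=; last by move=> j /andP[].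
apply: eq_bigr => b bP; apply: eq_big => [j|j _]; last by rewrite mxE.
by case: eqP => [->|]; rewrite ?bP ?andbT ?andbF.
Qed.

Lemma haf_block_pair B i j : (forall k l, B k l = B l k) -> i != j ->
  haf_block B [set i; j] = B i j.
Proof.
move=> symB; wlog ltij : i j / (i < j)%N => [H nij|_].
  have := nij; rewrite -val_eqE neq_ltn => /orP[lt|lt]; first exact: H.
  by rewrite setUC symB H // eq_sym.
have pairE (k l : 'I_N) : (k < l)%N && ([set k; l] == [set i; j]) = (k == i) && (l == j).
  apply/idP/idP => [/andP[ltkl /eqP E]|/andP[/eqP-> /eqP->]]; last by rewrite ltij eqxx.
  have := set21 k l; have := set22 k l; rewrite E !inE {E} => lE kE.
  move: ltkl; case/orP: lE => /eqP ->; case/orP: kE => /eqP ->;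
    rewrite ?ltnn ?eqxx // => ltji.
  by have := ltn_trans ltij ltji; rewrite ltnn.
rewrite /haf_block (bigD1 i) //= [X in _ * X]big1 ?mulr1.
  by under eq_bigl do rewrite pairE eqxx; rewrite big_pred1_eq.
move=> k /negPf nki; apply: big_pred0 => l.
by rewrite pairE nki.
Qed.

Lemma pmatching_partner P S i : pmatching P S -> i \in S ->
  exists2 j, j \in S :\ i & forall k, k != i -> ([set i; k] \in P) = (k == j).
Proof.
case/andP=> partP /forall_inP card2 iS.
have trivP := partition_trivIset partP; have coverP := cover_partition partP.
have iP : i \in cover P by rewrite coverP.
have bP := pblock_mem iP; have ib : i \in pblock P i by rewrite mem_pblock.
have /cards2P[k [l [nkl bE]]] := card2 _ bP.
have [j nji bE'] : exists2 j, j != i & pblock P i = [set i; j].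
  move: ib; rewrite bE !inE => /orP[] /eqP ->; first by exists l => //; rewrite eq_sym.
  by exists k; rewrite // setUC.
exists j => [|m nmi].
  rewrite !inE nji -coverP; apply/bigcupP; exists (pblock P i) => //.
  by rewrite bE' set22.
apply/idP/eqP => [imP|->]; last by rewrite -bE'.
have := def_pblock trivP imP (set21 i m); rewrite bE' => E.
by have := set22 i m; rewrite -E !inE (negPf nmi) => /eqP.
Qed.

Lemma pmatching_rem i j S P : i != j -> [set i; j] \in P ->
  pmatching P S -> pmatching (P :\ [set i; j]) (S :\: [set i; j]).
Proof.
move=> nij ijP /andP[partP /forall_inP card2]; rewrite /pmatching partitionD1 //=.
by apply/forall_inP => b /setD1P[_ /card2].
Qed.

Lemma pmatching_add i j S P : i != j -> i \in S -> j \in S ->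
  pmatching P (S :\: [set i; j]) -> pmatching ([set i; j] |: P) S.
Proof.
move=> nij iS jS /andP[partP /forall_inP card2]; apply/andP; split.
  have -> : S = [set i; j] :|: (S :\: [set i; j]).
    by rewrite -[LHS](setID S [set i; j]) (setIidPr _) // subUset !sub1set iS.
  apply: partitionU1 => //; first by apply/set0Pn; exists i; rewrite set21.
  by rewrite -setI_eq0 setIDA setIC -setIDA setDv setI0.
by apply/forall_inP => b /setU1P[->|/card2 //]; rewrite cards2 nij.
Qed.

Lemma hafset0 B : hafset B set0 = 1.
Proof.
rewrite /hafset (big_pred1 set0) ?big_set0 // => P.
rewrite /pmatching partition_set0 /=; case: (P =P set0) => [->|//] /=.
by apply/forall_inP => b; rewrite inE.
Qed.

(** Matchings are sorted by the partner [j] of [i]; deleting the block {i, j} is a bijection onto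
    the matchings of the remaining set. *)
Lemma hafset_expand B S i : (forall k l, B k l = B l k) -> i \in S ->
  hafset B S = \sum_(j in S :\ i) B i j * hafset B (S :\: [set i; j]).
Proof.
move=> symB iS; rewrite /hafset.
(* The default [i] is never reached when [P] is a matching of [S]. *)
pose partner P := odflt i [pick j | (j != i) && ([set i; j] \in P)].
have partnerE P : pmatching P S -> partner P \in S :\ i /\
    forall k, k != i -> ([set i; k] \in P) = (k == partner P).
  move=> mP; have [j jS jP] := pmatching_partner mP iS.
  have [nji _] := setD1P jS.
  suff -> : partner P = j by [].
  rewrite /partner; case: pickP => [k /andP[nki]|/(_ j)]; first by rewrite jP // => /eqP.
  by rewrite nji jP // eqxx.
rewrite (partition_big partner (mem (S :\ i))) /=; last by move=> P /partnerE[].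
apply: eq_bigr => j /setD1P[nji jS]; rewrite mulr_sumr.
have nij : i != j by rewrite eq_sym.
rewrite (reindex_onto (fun P => [set i; j] |: P) (fun P => P :\ [set i; j])) /=.
  apply: eq_big => P.
    apply/andP/idP => [[/andP[mP /eqP pj] /eqP <-]|mP].
      by rewrite pmatching_rem // setU11.
    have ijP : [set i; j] \notin P.
      apply/negP => ijP; case/andP: mP => /cover_partition cP _.
      have : i \in cover P by apply/bigcupP; exists [set i; j]; rewrite ?set21.
      by rewrite cP !inE eqxx.
    have mP' := pmatching_add nij iS jS mP; rewrite mP' setU1K // eqxx; split=> //=.
    by have [_ /(_ j nji)] := partnerE _ mP'; rewrite setU11 eq_sym => <-.
  case/andP=> /andP[mP /eqP pj] /eqP PE.
  have ijP : [set i; j] \notin P by rewrite -PE setD11.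
  by rewrite big_setU1 //= haf_block_pair.
move=> P /andP[mP /eqP pj]; rewrite setD1K //.
by have [_ /(_ j nji)] := partnerE _ mP; rewrite pj eqxx.
Qed.

End HafnianExpansion.

(** * The Pfaffian of (y_i - y_j) / (y_i + y_j)^2 *)

Section PfaffianHafnianIdentity.
Variables (F : fieldType).
Hypothesis char0 : forall m, (m.+1)%:R != 0 :> F.

(** Clearing denominators in the first-row expansion leaves a sum that is polynomial in [t], hence
    defined also at the points t = -y_j. *)
Lemma pf_square_recl n (t : F) (y : 'I_n.*2.+1 -> F) :
  (forall j, t + y j != 0) ->
  (\sum_(j < n.*2.+1) (-1) ^+ j * pf (fun k l : 'I_n.*2 =>
      (y (lift j k) - y (lift j l)) / (y (lift j k) + y (lift j l)) ^+ 2) *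
    ((t - y j) * \prod_k (t + y (lift j k)) ^+ 2)) =
  (\prod_j (t + y j)) ^+ 2 * pf (n := n.+1) (fun i j : 'I_n.*2.+2 =>
    (fcons t y i - fcons t y j) / (fcons t y i + fcons t y j) ^+ 2).
Proof.
move=> ty0; rewrite (@pf_expand _ char0 n) => [|i j]; last first.
  by rewrite -mulNr opprB [fcons t y j + _]addrC.
rewrite mulr_sumr; apply: eq_bigr => j _.
rewrite fcons0 fconsS (bigD1_ord j) //= prodrXl exprMn.
rewrite [in RHS](@eq_pf _ _ _ (fun k l : 'I_n.*2 =>
  (y (lift j k) - y (lift j l)) / (y (lift j k) + y (lift j l)) ^+ 2)); last first.
  by move=> k l; rewrite !fconsS.
move: (pf _) (\prod_k _) (ty0 j) ((-1) ^+ j) => p P tj s.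
by field.
Qed.

(** [hafset_expand] transported along [z], so that its terms carry the same [lift] indices as
    [pf_expand]. *)
Lemma hafset_image_recl N n (B : 'I_N -> 'I_N -> F) (z : 'I_n.*2.+2 -> 'I_N) :
  injective z -> (forall k l, B k l = B l k) ->
  hafset B [set z i | i : 'I_n.*2.+2] =
  \sum_(j < n.*2.+1) B (z ord0) (z (lift ord0 j)) *
    hafset B [set z (lift ord0 (lift j k)) | k : 'I_n.*2].
Proof.
move=> zinj symB.
rewrite (@hafset_expand _ _ _ _ (z ord0)) ?imset_f //.
have -> : [set z i | i : 'I_n.*2.+2] :\ z ord0 =
    [set z (lift ord0 j) | j : 'I_n.*2.+1].
  apply/setP => k; rewrite !inE; apply/andP/imsetP.
    move=> [nk /imsetP[i _ kE]]; case: (unliftP ord0 i) => [j|] iE.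
      by exists j => //; rewrite kE iE.
    by rewrite kE iE eqxx in nk.
  move=> [j _ ->]; split; last by rewrite imset_f.
  by rewrite (inj_eq zinj) eq_sym neq_lift.
rewrite big_imset /=; last by move=> i j _ _ /zinj /lift_inj.
apply: eq_big => [j|j _]; first by rewrite inE.
congr (_ * hafset _ _); apply/setP => k; rewrite !inE negb_or.
apply/andP/imsetP.
  move=> [/andP[nk0 nkj] /imsetP[i _ kE]].
  case: (unliftP ord0 i) => [l|] iE; last by rewrite kE iE eqxx in nk0.
  case: (unliftP j l) => [m|] lE; last by rewrite kE iE lE eqxx in nkj.
  by exists m => //; rewrite kE iE lE.
move=> [m _ ->]; rewrite imset_f // !(inj_eq zinj) (inj_eq lift_inj).
by rewrite eq_sym neq_lift eq_sym neq_lift.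
Qed.

(* Both sides, times [\prod_j (y_0 + y_j) ^+ 2], are polynomials in [y_0] of
   degree less than [4 n + 2].  They agree at [y_0 = - y_j] by induction, and at
   [y_0 = y_j] they both vanish, the Pfaffian having two equal rows. *)
Lemma pf_hafset N n (y : 'I_N -> F) (z : 'I_n.*2 -> 'I_N) :
  injective y -> injective z -> (forall i j, y i + y j != 0) ->
  pf (fun i j => (y (z i) - y (z j)) / (y (z i) + y (z j)) ^+ 2) =
  pairprod (fun i j => (y (z i) - y (z j)) / (y (z i) + y (z j))) *
  hafset (fun i j => 1 / (y i + y j)) [set z i | i : 'I_n.*2].
Proof.
move=> yinj zinj y0.
elim: n z zinj => [|n IHn] z zinj.
  rewrite pf0 /pairprod big_ord0 mul1r (_ : [set _ | _ in _] = set0) ?hafset0 //.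
  by apply/setP=> k; rewrite inE; apply/imsetP => -[[]].
set B := fun i j => 1 / (y i + y j).
pose Y (j : 'I_n.*2.+1) := y (z (lift ord0 j)).
have Yinj : injective Y by move=> i j /yinj /zinj /lift_inj.
have Y0 i j : Y i + Y j != 0 by exact: y0.
pose h (j : 'I_n.*2.+1) := hafset B [set z (lift ord0 (lift j k)) | k : 'I_n.*2].
pose p (j : 'I_n.*2.+1) := pf (fun k l : 'I_n.*2 =>
  (Y (lift j k) - Y (lift j l)) / (Y (lift j k) + Y (lift j l)) ^+ 2).
pose c (j : 'I_n.*2.+1) := pairprod (fun k l : 'I_n.*2 =>
  (Y (lift j k) - Y (lift j l)) / (Y (lift j k) + Y (lift j l))).
pose C := pairprod (fun k l => (Y k - Y l) / (Y k + Y l)).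
have pE j : p j = c j * h j.
  rewrite /p /c /h -(IHn (fun k => z (lift ord0 (lift j k)))) //.
  by move=> k l /zinj /lift_inj /lift_inj.
have CE (j : 'I_n.*2.+1) : C = (-1) ^+ j * \prod_(k < n.*2)
    ((Y j - Y (lift j k)) / (Y j + Y (lift j k))) * c j.
  rewrite /C (@pairprod_lift _ n.*2 _ j) // => k l.
  by rewrite -mulNr opprB [Y l + _]addrC.
pose L : {poly F} := \sum_(j < n.*2.+1) ((-1) ^+ j * p j) *:
  (('X - (Y j)%:P) * (\prod_k ('X + (Y (lift j k))%:P)) ^+ 2).
pose M : {poly F} := (C *: \prod_j ('X - (Y j)%:P)) *
  \sum_j h j *: \prod_k ('X + (Y (lift j k))%:P).
have hornerP (I : finType) (f : I -> F) t :
    (\prod_k ('X + (f k)%:P)).[t] = \prod_k (t + f k).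
  by rewrite horner_prod; apply: eq_bigr => k _; rewrite !hornerE.
have LE t : L.[t] = \sum_(j < n.*2.+1) (-1) ^+ j * p j *
    ((t - Y j) * \prod_k (t + Y (lift j k)) ^+ 2).
  rewrite horner_sum; apply: eq_bigr => j _.
  by rewrite hornerZ hornerM horner_exp hornerP hornerXsubC prodrXl.
have ME t : M.[t] = C * \prod_j (t - Y j) *
    \sum_j h j * \prod_k (t + Y (lift j k)).
  rewrite hornerM hornerZ horner_prod horner_sum; congr (_ * _ * _).
    by apply: eq_bigr => j _; rewrite hornerXsubC.
  by apply: eq_bigr => j _; rewrite hornerZ hornerP.
have LM : L = M.
  (* The 4n+2 nodes are all Y_k and all -Y_k; they are distinct because no sum Y_i + Y_j
     vanishes. *)
  pose pts (s : 'I_n.*2.+1 + 'I_n.*2.+1) := match s with inl k => Y k | inr k => - Y k end.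
  have ptsinj : injective pts.
    move=> [i|i] [j|j] /=.
    - by move/Yinj ->.
    - by move/eqP; rewrite -addr_eq0 (negPf (Y0 _ _)).
    - by move/esym/eqP; rewrite -addr_eq0 (negPf (Y0 _ _)).
    - by move/oppr_inj/Yinj ->.
  apply: (poly_eq_of_evals ptsinj).
  - rewrite card_sum !card_ord; apply: (leq_trans (size_sum _ _ _)).
    apply/bigmax_leqP => j _; apply: (leq_trans (size_scale_leq _ _)).
    apply: (leq_trans (size_polyMleq _ _)); rewrite size_XsubC expr2.
    set q := \prod_k _; have := size_polyMleq q q.
    by rewrite size_prod_XaddC; lia.
  - rewrite card_sum !card_ord; apply: (leq_trans (size_polyMleq _ _)).
    set q := \sum_j _; have sq : (size q <= n.*2.+1)%N.
      apply: (leq_trans (size_sum _ _ _)); apply/bigmax_leqP => j _.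
      by apply: (leq_trans (size_scale_leq _ _)); rewrite size_prod_XaddC.
    have sp := size_scale_leq C (\prod_j ('X - (Y j)%:P)).
    have sz : size (\prod_j ('X - (Y j)%:P)) = n.*2.+2.
      by rewrite size_prod_XsubC /index_enum -enumT size_enum_ord.
    rewrite sz in sp.
    by rewrite -subn1 leq_subLR (leq_trans (leq_add sp sq)) //; lia.
  - case=> k /=.
      rewrite LE ME pf_square_recl //.
      rewrite [X in _ * X = _](@pf_eq_rows _ char0 n.+1 _ (ord0 : 'I_n.*2.+2) (lift ord0 k)) ?neq_lift //.
      + by rewrite mulr0 [X in _ = _ * X * _](bigD1 k) //= subrr mul0r mulr0 mul0r.
      + by move=> i j; rewrite -mulNr opprB [fcons _ _ j + _]addrC.
      + by move=> j; rewrite fcons0 fconsS.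
    (* At -Y_k every term with j <> k contains the factor -Y_k + Y_k, so a single term survives on
       each side; [pE] and [CE] identify the two. *)
    rewrite LE ME (bigD1 k) //= [X in _ + X]big1 ?addr0; last first.
      move=> j njk; have [l -> _] := unlift_some njk.
      by rewrite [X in _ * (_ * X)](bigD1 l) //= addNr expr0n /= mul0r !mulr0.
    rewrite [X in _ = _ * X](bigD1 k) //= [X in _ = _ * (_ + X)]big1 ?addr0; last first.
      move=> j njk; have [l -> _] := unlift_some njk.
      by rewrite [X in _ * X](bigD1 l) //= addNr mul0r !mulr0.
    rewrite pE (CE k) [X in _ = _ * X * _](bigD1_ord k) //=.
    have subE : \prod_(l < n.*2) (- Y k + Y (lift k l)) =
        \prod_(l < n.*2) (Y k - Y (lift k l)).
      by rewrite [RHS]prod_subC_even; apply: eq_bigr => l _; rewrite addrC.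
    have addE : \prod_(l < n.*2) (- Y k - Y (lift k l)) =
        \prod_(l < n.*2) (Y k + Y (lift k l)).
      rewrite (prod_subC_even (fun=> - Y k)).
      by apply: eq_bigr => l _; rewrite opprK addrC.
    rewrite prodrXl prodf_div subE addE.
    have P0 : \prod_(l < n.*2) (Y k + Y (lift k l)) != 0 by apply/prodf_neq0.
    by move: (\prod_l (_ + _)) P0 => P P0; field.
pose t := y (z ord0).
have t0 j : t + Y j != 0 by exact: y0.
have D0 : \prod_j (t + Y j) != 0 by apply/prodf_neq0.
have zE i : y (z i) = fcons t Y i by rewrite -[RHS]/(fcons t Y i) (fcons_eta (y \o z)).
rewrite (@eq_pf _ n.+1 _ (fun i j : 'I_n.*2.+2 =>
  (fcons t Y i - fcons t Y j) / (fcons t Y i + fcons t Y j) ^+ 2)); last first.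
  by move=> i j; rewrite !zE.
apply: (mulfI (expf_neq0 2 D0)); rewrite -(pf_square_recl t0) -LE LM ME.
rewrite (@pairprod_recl _ n.*2.+1) hafset_image_recl //; last first.
  by move=> k l; rewrite /B addrC.
rewrite -/t -/C prodf_div [X in _ = _ * (_ * X)](_ : _ =
  (\sum_j h j * \prod_k (t + Y (lift j k))) / \prod_j (t + Y j)); last first.
  rewrite mulr_suml; apply: eq_bigr => j _; rewrite -/(h j).
  rewrite [X in _ = _ / X](bigD1_ord j) //= /B -/t -/(Y j).
  have P0 : \prod_(k < n.*2) (t + Y (lift j k)) != 0 by apply/prodf_neq0.
  move: (\prod_k _) P0 (t0 j) => P P0 tj.
  by field; rewrite P0.
move: (\prod_j (t + Y j)) D0 (\prod_j (t - Y j)) (\sum_j _) => D D0 Q S.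
by field.
Qed.

End PfaffianHafnianIdentity.

(** * Explicit entries of the merged sequences *)

Section Partitions.

Lemma perm_mkseq_dup (g : nat -> nat) m :
  perm_eq (mkseq g m ++ mkseq g m) (mkseq (fun j => g j./2) m.*2).
Proof.
elim: m => [//|m /seq.permP IHm]; apply/seq.permP => p.
rewrite doubleS !mkseqS -!cats1 !count_cat /= -IHm count_cat.
rewrite uphalf_double doubleK.
by move: (count p _) (nat_of_bool _) => u v; lia.
Qed.

Lemma sort_geq_mkseq s (f : nat -> nat) m :
  perm_eq s (mkseq f m) -> (forall j, f j.+1 <= f j)%N -> sort geq s = mkseq f m.
Proof.
have geq_total : total geq by move=> i j; exact: leq_total.
have geq_trans : transitive geq by move=> j i k ij jk; exact: leq_trans jk ij.
have geq_anti : antisymmetric geq by move=> i j; rewrite andbC => /anti_leq.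
move=> /(perm_sortP geq_total geq_trans geq_anti) -> fdecr.
apply: sorted_sort => //; apply/(sortedP 0) => i; rewrite size_mkseq => im.
by rewrite !nth_mkseq ?(ltnW im) //; exact: fdecr.
Qed.

Lemma delta_stepE d m :
  delta_step d.+1 (d.+1 * m)%N%:Z = mkseq (fun k => d.+1 * (m - k))%N m.+1.
Proof.
by rewrite /delta_step mulKn // /mkseq; apply: eq_map => k; rewrite mulnBr.
Qed.

(** Every value occurs twice, hence the index [j./2]. *)
Lemma delta_step2_diag d m :
  delta_step2 d.+1 (d.+1 * m)%N%:Z (d.+1 * m)%N%:Z =
  mkseq (fun j => d.+1 * (m - j./2))%N m.+1.*2.
Proof.
rewrite /delta_step2 delta_stepE; apply: sort_geq_mkseq => [|j].
  exact: (perm_mkseq_dup (fun k => d.+1 * (m - k))%N).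
by rewrite leq_mul2l leq_sub2l ?orbT // half_leq.
Qed.

Lemma mkseq_cons T (f : nat -> T) m :
  mkseq f m.+1 = f 0%N :: mkseq (fun i => f i.+1) m.
Proof. by rewrite /mkseq /= (iotaDl 1) -map_comp. Qed.

(** The top entry m+1 occurs once and every later value twice, hence [uphalf]. *)
Lemma delta_next m :
  delta (m.+1)%:Z m%:Z = mkseq (fun j => m.+1 - uphalf j)%N m.+1.*2.+1.
Proof.
have stepE k : delta_step 1 k%:Z = mkseq (fun i => k - i)%N k.+1.
  by have := delta_stepE 0 k; rewrite mul1n => ->; apply: eq_map => i; rewrite mul1n.
rewrite /delta_step2 !stepE; apply: sort_geq_mkseq => [|j]; last first.
  by rewrite leq_sub2l // !uphalfE half_leq.
rewrite [mkseq _ m.+2]mkseq_cons (mkseq_cons _ m.+1.*2) perm_cons.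
exact: (perm_mkseq_dup (fun k => m - k)%N m.+1).
Qed.

End Partitions.

(** * Characters as ratios of determinants, and Pfaffians over [2 * n] indices *)

Section Evaluation.
Variables (F : fieldType).

Lemma det_rev_cols N (f : 'I_N -> nat -> F) :
  \det (\matrix_(i < N, j < N) f i (N - j.+1)%N) =
  (-1) ^+ perm (@rev_ord_inj N) * \det (\matrix_(i < N, j < N) f i j).
Proof.
rewrite -odd_permV -det_perm mulrC -det_mulmx -col_permE; congr (\det _).
apply/matrixP => i j; rewrite !mxE; congr (f i _).
by rewrite permE.
Qed.

Lemma det_powers N (y : 'I_N -> F) :
  \det (\matrix_(i < N, j < N) y i ^+ j) = pairprod (fun i j => y j - y i).
Proof.
transitivity (\det (Vandermonde N (\row_i y i))).
  by rewrite -det_tr; congr (\det _); apply/matrixP => i j; rewrite !mxE.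
rewrite det_Vandermonde; apply: eq_bigr => i _; apply: eq_bigr => j _.
by rewrite !mxE.
Qed.

(** Column c is y^(odd c) (y^2)^(c/2) = y^c, so this is a Vandermonde determinant. *)
Lemma vdet_sqr N (y : 'I_N -> F) :
  vdet (fun i => y i ^+ 2) y = pairprod (fun i j => y j - y i).
Proof.
rewrite -det_powers; congr (\det _); apply/matrixP => i j; rewrite !mxE.
by rewrite -exprM -exprD mul2n odd_double_half.
Qed.

(** [GLchar] lists its columns by decreasing exponent; the sign of the reversal is the same in
    numerator and denominator and cancels. *)
Lemma GLchar_vdet N lam (z X A : 'I_N -> F) :
  (forall i j, (j < N)%N -> z i ^+ (nth 0%N lam j + (N - j.+1)) =
     A i ^+ odd (N - j.+1) * X i ^+ (N - j.+1)./2) ->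
  GLchar lam z = vdet X A / pairprod (fun i j => z j - z i).
Proof.
move=> zE; rewrite /GLchar (det_rev_cols (fun i j => z i ^+ j)) det_powers.
rewrite [X in X / _](_ : _ = (-1) ^+ perm (@rev_ord_inj N) * vdet X A).
  by rewrite invfM mulrACA divff ?signr_eq0 // mul1r.
rewrite -(det_rev_cols (fun i j => A i ^+ odd j * X i ^+ j./2)).
by congr (\det _); apply/matrixP => i j; rewrite !mxE zE.
Qed.

Lemma prod_dpos n (f : 'I_n.*2 -> F) :
  \prod_(i < n) (f (dfst i) * f (dsnd i)) = \prod_p f p.
Proof.
elim: n f => [|n IHn] f; first by rewrite !big_ord0.
rewrite big_ord_recl [RHS](@big_ord_recl _ _ _ n.*2.+1).
rewrite [X in _ = _ * X]big_ord_recl mulrA -IHn; congr (f _ * f _ * _).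
- exact: val_inj.
- exact: val_inj.
by apply: eq_bigr => i _; congr (f _ * f _); apply: val_inj.
Qed.

(** Every index occurs exactly once in each term of the Pfaffian. *)
Lemma pf_scale n (u : 'I_n.*2 -> F) (A : 'I_n.*2 -> 'I_n.*2 -> F) :
  pf (fun i j => u i * u j * A i j) = (\prod_i u i) * pf A.
Proof.
rewrite /pf mulrCA; congr (_ * _); rewrite mulr_sumr; apply: eq_bigr => s _.
rewrite /pfterm mulrCA big_split /= (prod_dpos (fun p => u (s p))).
by rewrite [X in _ = _ * (X * _)](reindex_inj (@perm_inj _ s)).
Qed.

Lemma pfaffian_scale n (u : 'I_(2 * n) -> F) (A : 'I_(2 * n) -> 'I_(2 * n) -> F) :
  pfaffian (\matrix_(i, j) (u i * u j * A i j)) =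
  (\prod_i u i) * pfaffian (\matrix_(i, j) A i j).
Proof.
rewrite !(pfaffian_pf (esym (mul2n n))).
under eq_pf do rewrite mxE; under [X in _ = _ * X]eq_pf do rewrite mxE.
move: (2 * n)%N (esym _) u A => N e; case: _ / e => u A.
by under eq_pf do rewrite !cast_ord_id; rewrite pf_scale;
  under [X in _ = _ * X]eq_pf do rewrite !cast_ord_id.
Qed.

Hypothesis char0 : forall m, (m.+1)%:R != 0 :> F.

Lemma pfaffian_vandermonde n (x a b : 'I_(2 * n) -> F) : injective x ->
  pfaffian (\matrix_(i, j) ((a i - a j) * (b i - b j) / (x i - x j))) *
    pairprod (fun i j => x i - x j) = vdet x a * vdet x b.
Proof.
rewrite (pfaffian_pf (esym (mul2n n))); under eq_pf do rewrite mxE.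
move: (2 * n)%N (esym _) x a b => N e; case: _ / e => x a b xinj.
rewrite -(pf_vandermonde char0) //; congr (_ * _); apply: eq_pf => i j.
by rewrite !cast_ord_id.
Qed.

Lemma pfaffian_hafnian n (y : 'I_(2 * n) -> F) :
  injective y -> (forall i j, y i + y j != 0) ->
  pfaffian (\matrix_(i, j) ((y i - y j) / (y i + y j) ^+ 2)) =
  pairprod (fun i j => (y i - y j) / (y i + y j)) *
  hafnian (\matrix_(i, j) (1 / (y i + y j))).
Proof.
move=> yinj y0; rewrite hafnian_hafset (pfaffian_pf (esym (mul2n n))).
under eq_pf do rewrite mxE.
move: (2 * n)%N (esym _) y yinj y0 => N e; case: _ / e => y yinj y0.
rewrite (_ : [set: _] = [set cast_ord erefl i | i : 'I_n.*2]); last first.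
  apply/setP => i; rewrite inE; apply/esym/imsetP.
  by exists i; rewrite ?cast_ord_id.
rewrite (pf_hafset char0 yinj) //; last exact: cast_ord_inj.
by congr (_ * _); apply: eq_pairprod => i j _; rewrite !cast_ord_id.
Qed.

(** * Reduction of [AQT] to the variables y = x^2 *)

Variables (n : nat) (x : 'I_(2 * n) -> F) (a c : F).
Hypotheses (x0 : forall i, x i != 0) (a0 : a != 0).
Hypothesis cE : a ^+ 2 + a ^- 2 = c.
Let y i := x i ^+ 2.
Let Q i j := y i ^+ 2 + y j ^+ 2 - c * (y i * y j).
Hypothesis yinj : injective y.
Hypothesis Q0 : forall i j, Q i j != 0.

(** With u = x_j / x_i the product expands to c - u^2 - u^-2, so [a] enters only through [c]. *)
Lemma sigma_pairE i j :
  sigma (a * x j / x i) * sigma (a * x i / x j) = - Q i j / (y i * y j).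
Proof.
rewrite /sigma /Q /y -cE; field.
by rewrite a0 !x0.
Qed.

(** Each index lies in N - 1 pairs. *)
Lemma pairprod_sym N (u : 'I_N -> F) :
  pairprod (fun i j => u i * u j) = \prod_i u i ^+ N.-1.
Proof.
elim: N u => [|N IHN] u; first by rewrite /pairprod !big_ord0.
rewrite pairprod_recl IHN big_split prodr_const card_ord /= big_ord_recl.
rewrite -mulrA -big_split /=; congr (_ * _); apply: eq_bigr => i _.
by case: N {IHN} u i => [|N] u i; [case: i | rewrite exprS].
Qed.

(** Since sigma(x_j / x_i) = (y_j - y_i) / (x_i x_j), its sign cancels that of [sigma_pairE], and a
    factor 1 / (x_i x_j) per pair is left over. *)
Lemma FQTE :
  FQT x a = (\prod_i x i ^+ (2 * n).-1)^-1 * pairprod (fun i j => Q i j / (y i - y j)).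
Proof.
rewrite /FQT -!/(pairprod _) -pairprod_sym -!pairprodV -!pairprodM.
apply: eq_pairprod => i j ltij; rewrite sigma_pairE /sigma.
have : y i - y j != 0 by rewrite subr_eq0 (inj_eq yinj) -val_eqE ltn_eqF.
rewrite /y => yij; field.
by rewrite yij !x0 mulNr -!expr2 -opprB oppr_eq0 yij.
Qed.

(** For k = 1 a factor x_i x_j remains, which [pfaffian_scale] turns into one more power of each
    x_i; for k = 2 nothing remains. Hence the exponents -2n+2 and -2n+1. *)
Lemma MQT1E : MQT 1 x a = \matrix_(i, j) (x i * x j * ((y i - y j) / Q i j)).
Proof.
apply/matrixP => i j; rewrite !mxE sigma_pairE /sigma !expr1 /y.
have := Q0 i j; move: (Q i j) => q q0; field.
by rewrite oppr_eq0 q0 !x0.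
Qed.

Lemma MQT2E : MQT 2 x a = \matrix_(i, j) ((y i ^+ 2 - y j ^+ 2) / Q i j).
Proof.
apply/matrixP => i j; rewrite !mxE sigma_pairE /sigma /y.
have := Q0 i j; move: (Q i j) => q q0; field.
by rewrite oppr_eq0 q0 !x0.
Qed.

Hypothesis n0 : (0 < n)%N.

Lemma sigma_power :
  sigma a ^ (- 2 * n%:Z ^+ 2 + 2 * n%:Z) = ((c - 2) ^+ (n * n.-1))^-1.
Proof.
have -> : c - 2 = sigma a ^+ 2 by rewrite /sigma -cE; field.
rewrite -exprM; have -> : - 2 * n%:Z ^+ 2 + 2 * n%:Z = - (2 * (n * n.-1))%N%:Z :> int.
  by case: n n0 => [//|m] _ /=; rewrite !PoszM; lia.
by rewrite -exprnN.
Qed.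

Lemma AQT1E :
  AQT 1 x a = ((c - 2) ^+ (n * n.-1))^-1 * (\prod_i x i ^ (- 2 * n%:Z + 2)) *
    (pairprod (fun i j => Q i j / (y i - y j)) *
     pfaffian (\matrix_(i, j) ((y i - y j) / Q i j))).
Proof.
rewrite /AQT sigma_power FQTE MQT1E pfaffian_scale -!mulrA; congr (_ * _).
rewrite mulrCA [RHS]mulrCA; congr (_ * _); rewrite mulrA; congr (_ * _).
rewrite -prodfV -big_split; apply: eq_bigr => i _ /=.
have -> : - 2 * n%:Z + 2 = - (2 * n.-1)%N%:Z :> int.
  by case: n n0 => [//|m] _ /=; rewrite PoszM; lia.
have -> : (2 * n).-1 = (2 * n.-1).+1 by case: n n0 => [//|m] _; lia.
by rewrite -exprnN exprSr invfM -mulrA mulVf ?mulr1.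
Qed.

Lemma AQT2E :
  AQT 2 x a = ((c - 2) ^+ (n * n.-1))^-1 * (\prod_i x i ^ (- 2 * n%:Z + 1)) *
    (pairprod (fun i j => Q i j / (y i - y j)) *
     pfaffian (\matrix_(i, j) ((y i ^+ 2 - y j ^+ 2) / Q i j))).
Proof.
rewrite /AQT sigma_power FQTE MQT2E -!mulrA; congr (_ * _).
rewrite -prodfV; congr (_ * _); apply: eq_bigr => i _ /=.
have -> : - 2 * n%:Z + 1 = - (2 * n).-1%:Z :> int.
  by case: n n0 => [//|m] _ /=; lia.
by rewrite -exprnN.
Qed.

End Evaluation.

(** * Algebraic equations of the roots of unity *)

Section Roots.
Variable R : realType.

Let cis (t : R) : R[i] := Complex (cos t) (sin t).

Lemma cisX t k : cis t ^+ k = cis (t *+ k).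
Proof.
elim: k => [|k IHk]; first by rewrite expr0 mulr0n /cis cos0 sin0.
rewrite exprS IHk mulrS /cis cosD sinD; apply/eqP; rewrite eq_complex /=.
by rewrite [sin t * _ + _]addrC !eqxx.
Qed.

Lemma zetaE m : zeta R m = cis (2 * pi / m%:R).
Proof.
rewrite /zeta; have -> : 2%:R * Complex 0 pi / m%:R = Complex 0 (2 * pi / m%:R) :> R[i].
  have -> : 2%:R = (2%:R : R)%:C%C by rewrite rmorph_nat.
  have -> : m%:R = (m%:R : R)%:C%C by rewrite rmorph_nat.
  by rewrite -fmorphV; apply/eqP; rewrite eq_complex /=; apply/andP; split; apply/eqP; ring.
by rewrite /cexp expR0 !mul1r.
Qed.

Lemma zeta_half m : (0 < m)%N -> zeta R (2 * m) ^+ m = -1.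
Proof.
move=> m0; rewrite zetaE cisX -[_ *+ m]mulr_natr [X in cis X](_ : _ = pi); last first.
  by rewrite natrM; field; rewrite pnatr_eq0 -lt0n m0.
by rewrite /cis cospi sinpi; apply/eqP; rewrite eq_complex /= oppr0 !eqxx.
Qed.

(** From z^3 = -1 one gets (z + 1)(z^2 - z + 1) = 0, and z = -1 is excluded because z has positive
    imaginary part. *)
Lemma zeta6_root : zeta R 6 ^+ 2 - zeta R 6 + 1 = 0.
Proof.
have z3 : (zeta R 6 + 1) * (zeta R 6 ^+ 2 - zeta R 6 + 1) = 0.
  by have /eqP := @zeta_half 3 isT; rewrite -subr_eq0 => /eqP <-; ring.
move/eqP: z3; rewrite mulf_eq0 => /orP[|/eqP //].
rewrite zetaE /cis eq_complex /= addr0 => /andP[_ /eqP s0].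
have : 0 < sin (2 * pi / 6%:R : R).
  have pi0 := pi_gt0 R; apply: sin_gt0_pi; apply/andP; split; first by rewrite divr_gt0 ?mulr_gt0.
  by rewrite ltr_pdivrMr // mulrC ltr_pM2l // ltr_nat.
by rewrite s0 ltxx.
Qed.

End Roots.

(** * The field of rational functions and its indeterminates *)

Section RationalFunctions.
Variables (R : realType) (N : nat).

Lemma ratfun_char0 m : (m.+1)%:R != 0 :> ratfun R N.
Proof.
have -> : (m.+1)%:R = tofrac (mpolyC N (m.+1%:R : R[i])) by rewrite !rmorph_nat.
by rewrite tofrac_eq0 mpolyC_eq0 pnatr_eq0.
Qed.

Lemma ratX_neq0 (i : 'I_N) : ratX R i != 0.
Proof.
rewrite /ratX tofrac_eq0; apply/eqP => /(congr1 (mcoeff U_(i)%MM)) /eqP.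
by rewrite mcoeffX eqxx mcoeff0 oner_eq0.
Qed.

Lemma ratX_pow_inj k : injective (fun i : 'I_N => ratX R i ^+ k.+1).
Proof.
move=> i j; rewrite /ratX -!rmorphXn => /eqP; rewrite tofrac_eq !mpolyXn => /eqP.
(* Equal monomials have equal coefficients at X_j^(k+1), and this coefficient is 1 only for
   X_j^(k+1) itself. *)
move/(congr1 (fun p => p@_(U_(j) *+ k.+1)%MM)); rewrite !mcoeffX eqxx.
case: eqP => [/mnmP /(_ i)|_ /eqP]; last by rewrite eq_sym oner_eq0.
by rewrite !mulmnE !mnm1E eqxx; case: eqP.
Qed.

End RationalFunctions.

(** * The Pfaffians at the three values of c *)

Section Cases.
Variables (F : fieldType) (n : nat) (y : 'I_(2 * n) -> F).
Hypothesis char0 : forall m, (m.+1)%:R != 0 :> F.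
Hypothesis ypow_inj : forall k, injective (fun i => y i ^+ k.+1).

Let subX0 k (i j : 'I_(2 * n)) : (i < j)%N -> y i ^+ k.+1 - y j ^+ k.+1 != 0.
Proof. by move=> ij; rewrite subr_eq0 (inj_eq (@ypow_inj k)) -val_eqE ltn_eqF. Qed.

(** The cross-multiplied hypothesis says nothing on the diagonal, hence the separate condition A i i
    = 0. *)
Lemma pfaffian_ratio (x a b : 'I_(2 * n) -> F) (A : 'I_(2 * n) -> 'I_(2 * n) -> F) :
  injective x -> (forall i, A i i = 0) ->
  (forall i j, A i j * (x i - x j) = (a i - a j) * (b i - b j)) ->
  pfaffian (\matrix_(i, j) A i j) =
  vdet x a * vdet x b * (pairprod (fun i j => x i - x j))^-1.
Proof.
move=> xinj A0 AE; rewrite -(pfaffian_vandermonde char0) // mulfK.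
  congr (pfaffian _); apply/matrixP => i j; rewrite !mxE -AE.
  have [<-|nij] := eqVneq i j; first by rewrite A0 !mul0r.
  by rewrite mulfK // subr_eq0 (inj_eq xinj).
by apply: pairprod_neq0 => i j ij; rewrite subr_eq0 (inj_eq xinj) -val_eqE ltn_eqF.
Qed.

(** Here x = y^3, a = y, b = y^k; for k = 1 the two determinants coincide, whence a square. The
    constant stays [- 1] so that [Q] has the shape coming from [AQT1E] and [AQT2E]. *)
Lemma case_zeta6 (k : nat) (Q := fun i j => y i ^+ 2 + y j ^+ 2 - - 1 * (y i * y j)) :
  (k = 1 \/ k = 2)%N -> (forall i j, Q i j != 0) ->
  pairprod (fun i j => Q i j / (y i - y j)) *
    pfaffian (\matrix_(i, j) ((y i ^+ k - y j ^+ k) / Q i j)) =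
  vdet (fun i => y i ^+ 3) y / pairprod (fun i j => y j - y i) *
  (vdet (fun i => y i ^+ 3) (fun i => y i ^+ k) / pairprod (fun i j => y j - y i)).
Proof.
move=> k12 Q0.
rewrite (@pfaffian_ratio (fun i => y i ^+ 3) y (fun i => y i ^+ k)) //; first last.
- by move=> i j; have := Q0 i j; rewrite /Q => q0; field.
- by move=> i; rewrite subrr mul0r.
have E : pairprod (fun i j => Q i j / (y i - y j)) *
    (pairprod (fun i j => y i ^+ 3 - y j ^+ 3))^-1 =
    (pairprod (fun i j => y j - y i))^-1 * (pairprod (fun i j => y j - y i))^-1.
  rewrite -!pairprodV -!pairprodM; apply: eq_pairprod => i j ij.
  have := subX0 0 ij; have := subX0 2 ij; rewrite /Q => d3 d1; field.
  by rewrite d3 -opprB oppr_eq0 d1.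
by rewrite mulrCA E mulrACA.
Qed.

(** Here x = y^4, a = y, b = y^2. The second determinant is a Vandermonde in y^2, so a single
    character remains. *)
Lemma case_zeta8_1 (Q := fun i j => y i ^+ 2 + y j ^+ 2 - 0 * (y i * y j)) :
  (forall i j, Q i j != 0) ->
  pairprod (fun i j => Q i j / (y i - y j)) *
    pfaffian (\matrix_(i, j) ((y i - y j) / Q i j)) =
  vdet (fun i => y i ^+ 4) y / pairprod (fun i j => y j - y i).
Proof.
move=> Q0.
have QE i j : Q i j = y i ^+ 2 + y j ^+ 2 by rewrite /Q mul0r subr0.
rewrite (@pfaffian_ratio (fun i => y i ^+ 4) y (fun i => y i ^+ 2)) //; first last.
- by move=> i j; have := Q0 i j; rewrite QE => q0; field.
- by move=> i; rewrite subrr mul0r.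
rewrite [X in _ * (_ * X * _)](_ : _ =
  vdet (fun i => (y i ^+ 2) ^+ 2) (fun i => y i ^+ 2)); last first.
  by apply: eq_vdet => i //; rewrite -exprM.
rewrite vdet_sqr -[X in _ * X]mulrA mulrCA; congr (_ * _).
rewrite -!pairprodV -!pairprodM; apply: eq_pairprod => i j ij.
have := subX0 0 ij; have := subX0 3 ij; rewrite QE => d4 d1; field.
by rewrite d4 -opprB oppr_eq0 d1.
Qed.

(** The entries are (y_i^2 - y_j^2) / (y_i^2 + y_j^2): Schur's Pfaffian in the variables y^2. *)
Lemma case_zeta8_2 (Q := fun i j => y i ^+ 2 + y j ^+ 2 - 0 * (y i * y j)) :
  (forall i j, Q i j != 0) ->
  pairprod (fun i j => Q i j / (y i - y j)) *
    pfaffian (\matrix_(i, j) ((y i ^+ 2 - y j ^+ 2) / Q i j)) =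
  pairprod (fun i j => y i + y j).
Proof.
move=> Q0.
have QE i j : Q i j = y i ^+ 2 + y j ^+ 2 by rewrite /Q mul0r subr0.
rewrite (@pfaffian_ratio (fun i => (y i ^+ 2) ^+ 2) (fun i => y i ^+ 2) (fun i => y i ^+ 2)); first last.
- by move=> i j; have := Q0 i j; rewrite QE => q0; field.
- by move=> i; rewrite subrr mul0r.
- by move=> i j; rewrite -!exprM => /ypow_inj.
rewrite vdet_sqr -!pairprodV -!pairprodM; apply: eq_pairprod => i j ij.
have := subX0 0 ij; have := subX0 3 ij; rewrite QE => d4 d1; field.
by rewrite d1 -!exprM d4.
Qed.

(** The entries reduce to (y_i - y_j) / (y_i + y_j), again Schur's Pfaffian. *)
Lemma case_zeta4_2 (Q := fun i j => y i ^+ 2 + y j ^+ 2 - - 2 * (y i * y j)) :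
  (forall i j, Q i j != 0) ->
  pairprod (fun i j => Q i j / (y i - y j)) *
    pfaffian (\matrix_(i, j) ((y i ^+ 2 - y j ^+ 2) / Q i j)) =
  pairprod (fun i j => y i + y j).
Proof.
move=> Q0.
rewrite (@pfaffian_ratio (fun i => y i ^+ 2) y y) //; first last.
- by move=> i j; have := Q0 i j; rewrite /Q => q0; field.
- by move=> i; rewrite subrr mul0r.
rewrite vdet_sqr -!pairprodV -!pairprodM; apply: eq_pairprod => i j ij.
have := subX0 0 ij; have := subX0 1 ij; rewrite /Q => d2 d1; field.
by rewrite d1 d2.
Qed.

Lemma case_zeta4_1 (Q := fun i j => y i ^+ 2 + y j ^+ 2 - - 2 * (y i * y j)) :
  (forall i j, y i + y j != 0) ->
  pairprod (fun i j => Q i j / (y i - y j)) *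
    pfaffian (\matrix_(i, j) ((y i - y j) / Q i j)) =
  pairprod (fun i j => y i + y j) * hafnian (\matrix_(i, j) (1 / (y i + y j))).
Proof.
move=> y0.
have QE i j : Q i j = (y i + y j) ^+ 2 by rewrite /Q; ring.
have -> : \matrix_(i, j) ((y i - y j) / Q i j) =
    \matrix_(i, j) ((y i - y j) / (y i + y j) ^+ 2).
  by apply/matrixP => i j; rewrite !mxE QE.
rewrite (pfaffian_hafnian char0) //; last by move=> i j yij; apply: (ypow_inj (k := 0)).
rewrite mulrA -pairprodM; congr (_ * _); apply: eq_pairprod => i j ij.
have := subX0 0 ij; rewrite QE => d1; have := y0 i j => s0; field.
by rewrite s0 d1.
Qed.

End Cases.

(** * The three characters as determinants [vdet] *)

Section GeneralLinearCharacters.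
Variables (F : fieldType) (n : nat) (y : 'I_(2 * n) -> F).
Hypothesis n0 : (0 < n)%N.
Let V := pairprod (fun i j => y j - y i).

(** With c = 2n-1-j the j-th entry is c/2 rounded down, so the exponents are 0, 1, 3, 4, 6, 7,
    ... *)
Lemma GLchar_delta_diag :
  GLchar (delta (n%:Z - 1) (n%:Z - 1)) y = vdet (fun i => y i ^+ 3) y / V.
Proof.
apply: GLchar_vdet; case: n n0 y => [//|m] _ z i j jm.
have -> : m.+1%:Z - 1 = (1 * m)%N%:Z by lia.
rewrite delta_step2_diag nth_mkseq; last by lia.
by rewrite -exprM -exprD; congr (_ ^+ _); lia.
Qed.

(** Now the j-th entry is c/2 rounded up and the exponents are 0, 2, 3, 5, 6, 8, ... The sequence
    has 2n+1 entries; its last one, 0, is cut off. *)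
Lemma GLchar_delta_next :
  GLchar (delta n%:Z (n%:Z - 1)) y = vdet (fun i => y i ^+ 3) (fun i => y i ^+ 2) / V.
Proof.
apply: GLchar_vdet; case: n n0 y => [//|m] _ z i j jm.
have -> : m.+1%:Z - 1 = m%:Z by lia.
rewrite delta_next nth_mkseq; last by lia.
by rewrite -!exprM -exprD; congr (_ ^+ _); lia.
Qed.

(** The entries are doubled, so the exponents are 0, 1, 4, 5, 8, 9, ... *)
Lemma GLchar_delta2_diag :
  GLchar (delta2 (2 * n%:Z - 2) (2 * n%:Z - 2)) y = vdet (fun i => y i ^+ 4) y / V.
Proof.
apply: GLchar_vdet; case: n n0 y => [//|m] _ z i j jm.
have -> : 2 * m.+1%:Z - 2 = (2 * m)%N%:Z by lia.
rewrite delta_step2_diag nth_mkseq; last by lia.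
by rewrite -exprM -exprD; congr (_ ^+ _); lia.
Qed.

End GeneralLinearCharacters.

(** The six identities over any field of characteristic 0: the roots of unity enter through their
    algebraic equations, the indeterminates through nonvanishing and through distinctness of the
    powers of their squares. *)
Lemma AQT_evaluations (F : fieldType) (n : nat) (x : 'I_(2 * n) -> F) (z4 z6 z8 : F)
    (y := fun i => x i ^+ 2) (n' := n%:Z) :
  (0 < n)%N -> (forall m, (m.+1)%:R != 0 :> F) -> (forall i, x i != 0) ->
  (forall k, injective (fun i => y i ^+ k.+1)) ->
  z4 ^+ 2 = -1 -> z6 ^+ 2 = z6 - 1 -> z8 ^+ 4 = -1 ->
  AQT 1 x z4 =
    (2 : F) ^ (- 2 * n' ^+ 2 + 2 * n')
    * (\prod_(i < 2 * n) x i ^ (- 2 * n' + 2))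
    * (\prod_(i < 2 * n) \prod_(j < 2 * n | (i < j)%N) (x i ^+ 2 + x j ^+ 2))
    * hafnian (\matrix_(i < 2 * n, j < 2 * n) (1 / (x i ^+ 2 + x j ^+ 2)))
  /\
  AQT 1 x z6 =
    (3 : F) ^ (- n' ^+ 2 + n')
    * (\prod_(i < 2 * n) x i ^ (- 2 * n' + 2))
    * GLchar (delta (n' - 1) (n' - 1)) y ^+ 2
  /\
  AQT 1 x z8 =
    (2 : F) ^ (- n' ^+ 2 + n')
    * (\prod_(i < 2 * n) x i ^ (- 2 * n' + 2))
    * GLchar (delta2 (2 * n' - 2) (2 * n' - 2)) y
  /\
  AQT 2 x z4 =
    (2 : F) ^ (- 2 * n' ^+ 2 + 2 * n')
    * (\prod_(i < 2 * n) x i ^ (- 2 * n' + 1))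
    * (\prod_(i < 2 * n) \prod_(j < 2 * n | (i < j)%N) (x i ^+ 2 + x j ^+ 2))
  /\
  AQT 2 x z6 =
    (3 : F) ^ (- n' ^+ 2 + n')
    * (\prod_(i < 2 * n) x i ^ (- 2 * n' + 1))
    * GLchar (delta (n' - 1) (n' - 1)) y
    * GLchar (delta n' (n' - 1)) y
  /\
  AQT 2 x z8 =
    (2 : F) ^ (- n' ^+ 2 + n')
    * (\prod_(i < 2 * n) x i ^ (- 2 * n' + 1))
    * (\prod_(i < 2 * n) \prod_(j < 2 * n | (i < j)%N) (x i ^+ 2 + x j ^+ 2)).
Proof.
move=> hn char0 x0 ypow_inj z4E z6E z8E.
have yinj : injective y by move=> i j yij; apply: (ypow_inj 0%N); rewrite yij.
have y0 i : y i != 0 by rewrite expf_neq0.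
have sum0 k i j : y i ^+ k.+1 + y j ^+ k.+1 != 0.
  have [<-|nij] := eqVneq i j.
    by rewrite -mulr2n -mulr_natr mulf_neq0 ?expf_neq0 ?(char0 1%N).
  (* If the sum vanishes, the squares of both powers agree, against injectivity at exponent 2(k+1);
     [.-1] matches the shift in [ypow_inj]. *)
  apply: contraNneq nij => E; apply/eqP/(ypow_inj (k.+1 * 2).-1).
  rewrite prednK ?muln_gt0 //; cbv beta; rewrite !exprM; apply/eqP; rewrite -subr_eq0 subr_sqr.
  by rewrite E mulr0.
have N1 : -1 != 0 :> F by rewrite oppr_eq0 oner_eq0.
have z40 : z4 != 0 by apply: contraNneq N1 => z; rewrite -z4E z expr0n.
have z80 : z8 != 0 by apply: contraNneq N1 => z; rewrite -z8E z expr0n.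
have z60 : z6 != 0.
  by apply: contraNneq N1 => z; have := z6E; rewrite z expr0n /= sub0r => <-.
have c4 : z4 ^+ 2 + z4 ^- 2 = - 2 by rewrite z4E; field.
have c8 : z8 ^+ 2 + z8 ^- 2 = 0.
  apply: (mulfI (expf_neq0 2 z80)); rewrite mulr0 mulrDr mulfV ?expf_neq0 //.
  by rewrite -exprD z8E addNr.
have c6 : z6 ^+ 2 + z6 ^- 2 = - 1.
  apply: (mulfI (expf_neq0 2 z60)); rewrite mulrDr mulfV ?expf_neq0 //.
  rewrite z6E (_ : (z6 - 1) * (z6 - 1) + 1 = z6 ^+ 2 - 2 * z6 + 2); last by ring.
  by rewrite z6E; ring.
have Q4 i j : y i ^+ 2 + y j ^+ 2 - - 2 * (y i * y j) != 0.
  have -> : y i ^+ 2 + y j ^+ 2 - - 2 * (y i * y j) = (y i ^+ 1 + y j ^+ 1) ^+ 2 by ring.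
  by rewrite expf_neq0.
have Q8 i j : y i ^+ 2 + y j ^+ 2 - 0 * (y i * y j) != 0 by rewrite mul0r subr0.
(* On the diagonal the value is 3 y_i^2; elsewhere it divides y_i^3 - y_j^3. *)
have Q6 i j : y i ^+ 2 + y j ^+ 2 - - 1 * (y i * y j) != 0.
  have [<-|nij] := eqVneq i j.
    have -> : y i ^+ 2 + y i ^+ 2 - - 1 * (y i * y i) = 3%:R * y i ^+ 2 by ring.
    by rewrite mulf_neq0 ?expf_neq0 ?(char0 2%N).
  apply: contraNneq nij => E; apply/eqP/(ypow_inj 2%N)/eqP.
  rewrite -subr_eq0 (_ : _ - _ = (y i - y j) *
    (y i ^+ 2 + y j ^+ 2 - - 1 * (y i * y j))); last by ring.
  by rewrite E mulr0.
(* At the three roots c - 2 is -4, -3, -2. As n(n-1) is even the signs drop out, leaving powers of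
   2^2, 3 and 2. *)
have even_m : odd (n * n.-1) = false 
  by rewrite oddM -{1}(prednK hn) /= andNb.
have pow_n (u : F) : u ^ (- n' ^+ 2 + n') = (u ^+ (n * n.-1))^-1.
  have -> : - n' ^+ 2 + n' = - (n * n.-1)%N%:Z :> int.
    by rewrite /n' -{1 2 3}(prednK hn) PoszM; move: n.-1 => m; lia.
  by rewrite -exprnN.
have pow_2n (u : F) : u ^ (- 2 * n' ^+ 2 + 2 * n') = ((- (u ^+ 2)) ^+ (n * n.-1))^-1.
  rewrite (_ : - 2 * n' ^+ 2 + 2 * n' = 2 * (- n' ^+ 2 + n')); last by ring.
  by rewrite -exprz_exp pow_n exprNn -signr_odd even_m mul1r.
have pow_opp (u : F) : (- u) ^+ (n * n.-1) = u ^+ (n * n.-1).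
  by rewrite exprNn -signr_odd even_m mul1r.
have d4 : - 2 - 2 = - (2 ^+ 2) :> F by ring.
have d6 : - 1 - 2 = - 3 :> F by ring.
rewrite (AQT1E x0 z40 c4 yinj Q4 hn) (AQT1E x0 z60 c6 yinj Q6 hn) (AQT1E x0 z80 c8 yinj Q8 hn).
rewrite (AQT2E x0 z40 c4 yinj Q4 hn) (AQT2E x0 z60 c6 yinj Q6 hn) (AQT2E x0 z80 c8 yinj Q8 hn).
rewrite !pow_2n !pow_n d4 d6 sub0r !pow_opp.
rewrite GLchar_delta_diag // GLchar_delta_next // GLchar_delta2_diag //.
split; first by rewrite -[RHS]mulrA; congr (_ * _); exact: (case_zeta4_1 char0 ypow_inj (sum0 0%N)).
split; first by congr (_ * _); exact: (case_zeta6 char0 ypow_inj (or_introl erefl) Q6).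
split; first by congr (_ * _); exact: (case_zeta8_1 char0 ypow_inj Q8).
split; first by congr (_ * _); exact: (case_zeta4_2 char0 ypow_inj Q4).
split; first by rewrite -[RHS]mulrA; congr (_ * _); exact: (case_zeta6 char0 ypow_inj (or_intror erefl) Q6).
by congr (_ * _); exact: (case_zeta8_2 char0 ypow_inj Q8).
Qed.

Theorem theorem2p4 (R : realType) (n : nat) (hn : (1 <= n)%N) :
  let K := ratfun R (2 * n) in
  let x : 'I_(2 * n) -> K := fun i => ratX R i in
  let x2 : 'I_(2 * n) -> K := fun i => x i ^+ 2 in
  let zeta4 : K := ratC (2 * n) (zeta R 4) in
  let zeta6 : K := ratC (2 * n) (zeta R 6) in
  let zeta8 : K := ratC (2 * n) (zeta R 8) in
  let n' : int := n%:Z in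
  AQT 1 x zeta4 =
    (2 : K) ^ (- 2 * n' ^+ 2 + 2 * n')
    * (\prod_(i < 2 * n) x i ^ (- 2 * n' + 2))
    * (\prod_(i < 2 * n) \prod_(j < 2 * n | (i < j)%N) (x i ^+ 2 + x j ^+ 2))
    * hafnian (\matrix_(i < 2 * n, j < 2 * n) (1 / (x i ^+ 2 + x j ^+ 2)))
  /\
  AQT 1 x zeta6 =
    (3 : K) ^ (- n' ^+ 2 + n')
    * (\prod_(i < 2 * n) x i ^ (- 2 * n' + 2))
    * GLchar (delta (n' - 1) (n' - 1)) x2 ^+ 2
  /\
  AQT 1 x zeta8 =
    (2 : K) ^ (- n' ^+ 2 + n')
    * (\prod_(i < 2 * n) x i ^ (- 2 * n' + 2))
    * GLchar (delta2 (2 * n' - 2) (2 * n' - 2)) x2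
  /\
  AQT 2 x zeta4 =
    (2 : K) ^ (- 2 * n' ^+ 2 + 2 * n')
    * (\prod_(i < 2 * n) x i ^ (- 2 * n' + 1))
    * (\prod_(i < 2 * n) \prod_(j < 2 * n | (i < j)%N) (x i ^+ 2 + x j ^+ 2))
  /\
  AQT 2 x zeta6 =
    (3 : K) ^ (- n' ^+ 2 + n')
    * (\prod_(i < 2 * n) x i ^ (- 2 * n' + 1))
    * GLchar (delta (n' - 1) (n' - 1)) x2
    * GLchar (delta n' (n' - 1)) x2
  /\
  AQT 2 x zeta8 =
    (2 : K) ^ (- n' ^+ 2 + n')
    * (\prod_(i < 2 * n) x i ^ (- 2 * n' + 1))
    * (\prod_(i < 2 * n) \prod_(j < 2 * n | (i < j)%N) (x i ^+ 2 + x j ^+ 2)).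
Proof.
move=> K x y z4 z6 z8 n'.
have ratCX c k : ratC (2 * n) c ^+ k = ratC (2 * n) (c ^+ k) by rewrite /ratC !rmorphXn.
apply: AQT_evaluations => //.
- exact: ratfun_char0.
- exact: ratX_neq0.
(* The exponent of x_i is 2(k+1), written as the successor of its predecessor to fit
   [ratX_pow_inj]. *)
- move=> k i j; rewrite -!exprM; exact: (@ratX_pow_inj R (2 * n) (2 * k.+1).-1).
- by rewrite ratCX (@zeta_half R 2) // /ratC !rmorphN1.
- rewrite ratCX; have /eqP := zeta6_root R.
  rewrite -addrA addr_eq0 => /eqP ->.
  by rewrite opprD opprK /ratC !rmorphB !rmorph1.
- by rewrite ratCX (@zeta_half R 4) // /ratC !rmorphN1.
Qed.
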